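(* For every integer $d\ge 1$ there exist constants $B,C>0$, depending only on $d$, such that for all $N\in\mathbb{N}$ large enough, for all $t\ge 0$, and for all $x,y\in\mathbb{T}^d_N$ with $|x-y|=1$, $$\mathbb{E}\bigl[\bigl(\eta_t(0,x)-\eta_t(0,y)\bigr)^2\bigr]\;\le\;\frac{C}{\bigl(N^{2d+2}\wedge t^{d+1}\bigr)\vee 1}\,\exp\Bigl(-\frac{2t}{t_{\rm rel}}+\frac{Bt}{N^{d+2}}\Bigr),$$ where $\eta_t(0,\cdot)$ is the averaging process on $\mathbb{T}^d_N$ started from the unit mass at $0$ and $t_{\rm rel}=1/(1-\cos(2\pi/N))$.
   Context: $\mathbb{T}^d_N=(\mathbb{Z}/N\mathbb{Z})^d$ is the discrete torus with graph distance $|x-y|$ (nearest neighbors are pairs with $|x-y|=1$); $\mathcal{P}(\mathbb{T}^d_N)$ is the set of probability mass functions on $\mathbb{T}^d_N$. Averaging process: the Markov jump process on $\mathcal{P}(\mathbb{T}^d_N)$ with generator $\mathcal{L}f(\eta)=\frac12\sum_{x\in\mathbb{T}^d_N}\sum_{y:|x-y|=1}\bigl(f(\eta^{xy})-f(\eta)\bigr)$ for continuous $f$, where $\eta^{xy}(z)=\frac12(\eta(x)+\eta(y))$ if $z\in\{x,y\}$ and $\eta^{xy}(z)=\eta(z)$ otherwise. That is, each unordered nearest-neighbor pair has an independent rate-1 Poisson clock, and when it rings the two masses are replaced by their average. $\mathbb{P},\mathbb{E}$ are the law and expectation of the random updates. $\eta_t(0,\cdot)$ denotes the process at time $t$ started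 from the Dirac mass $\mathbf{1}_0$ at $0\in\mathbb{T}^d_N$. $t_{\rm rel}=1/\lambda$ is the relaxation time of the random walk with generator $L^{\rm RW}\psi(x)=\frac12\sum_{y:|x-y|=1}(\psi(y)-\psi(x))$, where $\lambda=1-\cos(2\pi/N)$ is its spectral gap (smallest non-zero eigenvalue of $-L^{\rm RW}$). Notation: $a\wedge b=\min\{a,b\}$, $a\vee b=\max\{a,b\}$. *)

(* Defs.v *)
From HB Require Import structures.
From mathcomp Require Import all_boot all_order all_algebra.
From mathcomp Require Import all_classical all_reals all_analysis.

Set Implicit Arguments.
Unset Strict Implicit.
Unset Printing Implicit Defensive.

Import Order.TTheory GRing.Theory Num.Theory.
Import numFieldNormedType.Exports.

Local Open Scope classical_set_scope.
Local Open Scope ring_scope.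

(* 'Z_N is Z/NZ only for N >= 2: 'Z_0 and 'Z_1 are both Z/2Z. *)
Definition torus (d N : nat) : finType := {ffun 'I_d -> 'Z_N}.

Definition origin (d N : nat) : torus d N := [ffun=> 0].

(* The graph distance of the d-fold product of the cycle Z/NZ is the sum over
   the coordinates of the distance min(k, N - k) on the cycle, where k is the
   representative of x_i - y_i in {0, ..., N-1}. *)
Definition torus_dist (d N : nat) (x y : torus d N) : nat :=
  (\sum_(i < d) minn (x i - y i)%R (N - (x i - y i)%R))%N.

(* Real functions on the torus, with the product topology. *)
Definition config (R : realType) (d N : nat) : topologicalType :=
  {ptws torus d N -> R}.

Definition prob_configs (R : realType) (d N : nat) : set (config R d N) :=
  [set eta | (forall x, 0 <= eta x) /\ \sum_(x : torus d N) eta x = 1].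

Definition unit_mass (R : realType) (d N : nat) (x : torus d N) :
  config R d N := fun z => (z == x)%:R.

Definition average (R : realType) (d N : nat) (x y : torus d N)
    (eta : config R d N) : config R d N :=
  fun z => if (z == x) || (z == y) then (eta x + eta y) / 2 else eta z.

Definition averaging_generator (R : realType) (d N : nat)
    (f : config R d N -> R) (eta : config R d N) : R :=
  2^-1 * \sum_(x : torus d N) \sum_(y : torus d N | torus_dist x y == 1%N)
           (f (average x y eta) - f eta).

(* Markov semigroups on C(E), for E a compact subset of X.  Elements of C(E)
   are represented by functions on X, of which only the values on E matter. *)
Record markov_semigroup (R : realType) (X : topologicalType) (E : set X)
    (S : R -> (X -> R) -> (X -> R)) : Prop := MarkovSemigroup {
  semigroup_continuous : forall (t : R) (f : X -> R), 0 <= t ->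
    {within E, continuous f} -> {within E, continuous (S t f)} ;
  semigroup_linear : forall (t : R) (a : R) (f g : X -> R), 0 <= t ->
    {within E, continuous f} -> {within E, continuous g} ->
    {in E, forall x, S t (fun z => a * f z + g z) x = a * S t f x + S t g x} ;
  semigroup_positive : forall (t : R) (f : X -> R), 0 <= t ->
    {within E, continuous f} ->
    {in E, forall x, 0 <= f x} -> {in E, forall x, 0 <= S t f x} ;
  semigroup_one : forall t : R, 0 <= t -> {in E, forall x, S t (cst 1) x = 1} ;
  semigroup0 : forall f : X -> R, {within E, continuous f} ->
    {in E, forall x, S 0 f x = f x} ;
  semigroupD : forall (s t : R) (f : X -> R), 0 <= s -> 0 <= t ->
    {within E, continuous f} ->
    {in E, forall x, S (s + t) f x = S s (S t f) x} ;
  semigroup_cvg0 : forall f : X -> R, {within E, continuous f} ->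
    forall e : R, 0 < e ->
      \forall h \near 0^'+, {in E, forall x, `|S h f x - f x| <= e} }.

(* The generator of S is defined on all of C(E), where it is equal to L. *)
Definition has_generator (R : realType) (X : topologicalType) (E : set X)
    (S : R -> (X -> R) -> (X -> R)) (L : (X -> R) -> (X -> R)) : Prop :=
  forall f : X -> R, {within E, continuous f} ->
    {within E, continuous (L f)} /\
    forall e : R, 0 < e ->
      \forall h \near 0^'+,
        {in E, forall x, `|(S h f x - f x) / h - L f x| <= e}.

(* sigma(Y_u : 0 <= u <= t) *)
Definition natural_filtration (R : realType) (Omega : Type)
    (X : topologicalType) (Y : R -> Omega -> X) (t : R) : set (set Omega) :=
  <<s [set A | exists (u : R) U, [/\ 0 <= u <= t, open U & A = Y u @^-1` U]] >>.

(* Right-continuous and piecewise constant, with finitely many jumps in every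
   bounded time interval. *)
Definition jump_path (R : realType) (X : Type) (p : R -> X) : Prop :=
  (forall t : R, 0 <= t -> \forall s \near t^'+, p s = p t) /\
  (forall t : R, 0 < t -> exists c, \forall s \near t^'-, p s = c).

(* Times range over R, but only the values at nonnegative times matter. *)
Record markov_jump_process (R : realType) (disp : measure_display)
    (Omega : measurableType disp) (P : probability Omega R)
    (X : topologicalType) (E : set X) (L : (X -> R) -> (X -> R)) (x0 : X)
    (Y : R -> Omega -> X) : Prop := MarkovJumpProcess {
  process_measurable : forall (t : R) U, 0 <= t -> open U ->
    measurable (Y t @^-1` U) ;
  process_state : forall (t : R) w, 0 <= t -> E (Y t w) ;
  process_start : {ae P, forall w, Y 0 w = x0} ;
  process_jump : {ae P, forall w, jump_path (fun t => Y t w)} ;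
  (* E[f(Y_(t+s)) | F_t] = (S_s f)(Y_t), tested against the events A of F_t. *)
  process_markov : exists S : R -> (X -> R) -> (X -> R),
    [/\ markov_semigroup E S, has_generator E S L &
      forall (t s : R) (f : X -> R) A, 0 <= t -> 0 <= s ->
        {within E, continuous f} -> natural_filtration Y t A ->
        (\int[P]_(w in A) (f (Y (t + s) w))%:E =
         \int[P]_(w in A) (S s f (Y t w))%:E)%E] }.

Definition averaging_process (R : realType) (d N : nat)
    (disp : measure_display) (Omega : measurableType disp)
    (P : probability Omega R) (eta0 : config R d N)
    (eta : R -> Omega -> config R d N) : Prop :=
  markov_jump_process P (@prob_configs R d N) (@averaging_generator R d N)
    eta0 eta.

Definition relaxation_time (R : realType) (N : nat) : R :=
  1 / (1 - cos (2 * pi / N%:R)).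

(* Main.v *)
(** Write [M_s f] for the expectation of [f] under the process at time [s], and
    [a_s(x,y) = M_s((eta x - eta y)^2)].  The generator [L] maps [<eta,g>^2] to
      [2 <eta,g> <eta,Lap g> + 1/8 sum_(x~y) (eta x - eta y)^2 (g x - g y)^2].
    - Duhamel: letting [g_s] be the backward heat flow ending at [1_x - 1_y] at
      time [t], the first term cancels, so [a_t(x,y)] is the square of the heat
      kernel gradient plus the integral of [1/8 sum a_s (g_s x - g_s y)^2].  As
      [|g_s|^2] has derivative [1/2 sum (g_s x - g_s y)^2] and ends at 2, times
      [s] close to [t] contribute at most half of the supremum of [a_s] there:
      this is a contraction.
    - For the other times, a sup bound on the heat kernel gradient leaves the
      exponentially weighted time integral of [sum_(x~y) a_s].  It is bounded by
      a weighted sum of squared Fourier coefficients of [eta], with resolvent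
      weights [symbol / (2 symbol - beta)], which is a Lyapunov function.  The
      slowest modes force the loss from [2/t_rel] to
      [beta = 2/t_rel - 1/N^(d+2)].
    Inequalities between derivatives replace all time integrals. *)

Require Import Defs.
From HB Require Import structures.
From mathcomp Require Import all_boot all_order all_algebra.
From mathcomp Require Import all_classical all_reals all_analysis.
From mathcomp Require Import ring lra.
From mathcomp Require Import zify.
Import Order.TTheory GRing.Theory Num.Theory.
Import numFieldNormedType.Exports.
Set Implicit Arguments.
Unset Strict Implicit.
Unset Printing Implicit Defensive.
Local Open Scope classical_set_scope.
Local Open Scope ring_scope.

(** Duhamel alone does not close: the integral costs a factor 1/2 only against the supremum of
    [a_s], and the bound available at early times is far larger than the one wanted at time [t]. The
    near times therefore form a window proportional to min(N^2, t): short enough that the claimed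
    bound changes by a factor at most 3/2 across it, so that the contraction factor is 3/4, and long
    enough that outside it the kernel gradient has, up to a constant and the exponential, the size
    it has at time [t]. The loss 1/N^(d+2) is the price of the slowest modes. There are 2 d of them,
    their resolvent weight is 8 gap / delta with gap = 1/t_rel and delta = 2/t_rel - beta, and the
    Lyapunov function averages over N^d modes. As gap has order N^-2, delta = N^-(d+2) is the
    smallest order for which this function starts bounded. Every other nonzero mode has symbol at
    least 2 gap, hence weight at most 8 whatever delta is. *)

(** * Differential inequalities on the half-line of times *)

(** A semigroup is constrained only at nonnegative times, so no two-sided derivative at 0 is
    available. Derivatives at positive times together with right continuity at 0 are what the mean
    value theorem needs on an interval starting at 0. *)
Definition forward_derivable (R : realType) (F dF : R -> R) : Prop :=
  (forall s : R, 0 < s -> is_derive s 1 F (dF s)) /\ F x @[x --> 0^'+] --> F 0.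

Section forward_derivable.
Context {R : realType}.
Implicit Types F G dF dG : R -> R.

Lemma forward_derivable_everywhere F dF :
  (forall s : R, is_derive s 1 F (dF s)) -> forward_derivable F dF.
Proof.
move=> dFP; split=> [s _|]; first exact: dFP.
apply: cvg_at_right_filter.
apply: differentiable_continuous; apply/derivable1_diffP.
by have [] := dFP 0.
Qed.

Lemma forward_derivable_ext F dF dG :
  forward_derivable F dF -> (forall s, 0 < s -> dF s = dG s) ->
  forward_derivable F dG.
Proof. by move=> [h1 h2] e; split=> // s s0; rewrite -e //; exact: h1. Qed.

Lemma forward_derivable_cst (c : R) : forward_derivable (fun=> c) (fun=> 0).
Proof. by apply: forward_derivable_everywhere => s; exact: is_derive_cst. Qed.

Lemma forward_derivableD F G dF dG :
  forward_derivable F dF -> forward_derivable G dG ->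
  forward_derivable (fun s => F s + G s) (fun s => dF s + dG s).
Proof.
move=> [dF1 dF2] [dG1 dG2]; split=> [s s0|]; last exact: cvgD.
by have := dF1 s s0; have := dG1 s s0 => ? ?; exact: is_deriveD.
Qed.

Lemma forward_derivableM F G dF dG :
  forward_derivable F dF -> forward_derivable G dG ->
  forward_derivable (fun s => F s * G s) (fun s => dF s * G s + F s * dG s).
Proof.
move=> [dF1 dF2] [dG1 dG2]; split=> [s s0|]; last exact: cvgM.
have := dF1 s s0; have := dG1 s s0 => ? ?.
apply: is_derive_eq (is_deriveM _ _) _.
by rewrite addrC; congr (_ + _); rewrite /GRing.scale /= mulrC.
Qed.

Lemma forward_derivableZ (c : R) F dF : forward_derivable F dF ->
  forward_derivable (fun s => c * F s) (fun s => c * dF s).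
Proof.
move=> dFP; have := forward_derivableM (forward_derivable_cst c) dFP.
by move/forward_derivable_ext; apply => s _; rewrite mul0r add0r.
Qed.

Lemma forward_derivable_sum (I : Type) (r : seq I) (P : pred I)
    (F dF : I -> R -> R) :
  (forall i, P i -> forward_derivable (F i) (dF i)) ->
  forward_derivable (fun s => \sum_(i <- r | P i) F i s)
                    (fun s => \sum_(i <- r | P i) dF i s).
Proof.
move=> dFP; elim: r => [|i r IH].
  rewrite [X in forward_derivable X](_ : _ = fun=> 0); last first.
    by apply/funext => s; rewrite big_nil.
  rewrite [X in forward_derivable _ X](_ : _ = fun=> 0); last first.
    by apply/funext => s; rewrite big_nil.
  exact: forward_derivable_cst.
rewrite [X in forward_derivable X](_ : _ = fun s =>
  if P i then F i s + \sum_(j <- r | P j) F j s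
  else \sum_(j <- r | P j) F j s); last by apply/funext => s; rewrite big_cons.
rewrite [X in forward_derivable _ X](_ : _ = fun s =>
  if P i then dF i s + \sum_(j <- r | P j) dF j s
  else \sum_(j <- r | P j) dF j s); last by apply/funext => s; rewrite big_cons.
by case: (P i) (dFP i) => // /(_ isT) dFi; exact: forward_derivableD.
Qed.

Lemma is_derive_expR_affine (a b s : R) :
  is_derive s 1 (fun x : R => expR (a * (x - b))) (a * expR (a * (s - b))).
Proof.
have h : is_derive s 1 (fun x : R => a * (x - b)) a.
  apply: is_derive_eq
    (is_deriveZ a (is_deriveB (is_derive_id s 1) (is_derive_cst b s 1))) _.
  by rewrite subr0 /GRing.scale /= mulr1.
have := @is_derive1_comp R expR (fun x => a * (x - b)) s _ _ (is_derive_expR _) h.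
by rewrite mulrC.
Qed.

Lemma forward_derivable_expR (a b : R) :
  forward_derivable (fun x => expR (a * (x - b))) (fun x => a * expR (a * (x - b))).
Proof.
by apply: forward_derivable_everywhere => s; exact: is_derive_expR_affine.
Qed.

(** The mean value theorem for [F - G]. It stands in for integrating [dF <= dG], so no integrability
    in time ever has to be checked. *)
Lemma forward_derivable_le F G dF dG (a b : R) :
  forward_derivable F dF -> forward_derivable G dG -> 0 <= a <= b ->
  (forall s : R, a < s < b -> dF s <= dG s) -> F b - F a <= G b - G a.
Proof.
move=> hF hG /andP[a0 ab] le_dFG.
move: ab; rewrite le_eqVlt => /predU1P[->|ab]; first by rewrite !subrr.
have [dH H0] := forward_derivableD hF (forward_derivableZ (-1) hG).
set H := fun s => _ in dH H0.
have Hc (s : R) : 0 < s -> {for s, continuous H}.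
  move=> s0; apply: differentiable_continuous; apply/derivable1_diffP.
  by have [] := dH s s0.
have [||s sab] := @MVT R H (fun s => dF s + -1 * dG s) a b ab.
- by move=> s; rewrite in_itv /= => /andP[as_ _]; apply: dH; apply: le_lt_trans as_.
- apply/continuous_within_itvP => //; split.
  + by move=> s; rewrite in_itv /= => /andP[as_ _]; apply: Hc; apply: le_lt_trans as_.
  + move: a0; rewrite le_eqVlt => /predU1P[<- //|a0].
    by apply: cvg_at_right_filter; exact: Hc.
  + by apply: cvg_at_left_filter; apply: Hc; exact: le_lt_trans ab.
move: sab; rewrite in_itv /= => /le_dFG les.
have dH0 : (dF s + -1 * dG s) * (b - a) <= 0.
  by rewrite mulN1r mulr_le0_ge0 ?subr_le0 ?subr_ge0 // ltW.
by rewrite /H => e; move: dH0; rewrite -e; lra.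
Qed.
End forward_derivable.

(** * Markov semigroups *)

Section markov_semigroup.
Context {R : realType} {X : topologicalType} {E : set X}.
Context {S : R -> (X -> R) -> X -> R} {L : (X -> R) -> X -> R}.
Hypothesis semiS : markov_semigroup E S.
Hypothesis genS : has_generator E S L.
Implicit Types (f g : X -> R) (s t : R) (x : X).

Let within_cst (c : R) : {within E, continuous (fun _ : X => c)}.
Proof. by move=> x; exact: cvg_cst. Qed.

Let within_lin (a : R) f g : {within E, continuous f} -> {within E, continuous g} ->
  {within E, continuous (fun x => a * f x + g x)}.
Proof.
move=> cf cg x; apply: cvgD; last exact: cg.
by apply: cvgM; [exact: cvg_cst | exact: cf].
Qed.

Lemma semigroup_cst t (c : R) x : 0 <= t -> x \in E -> S t (fun=> c) x = c.
Proof.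
move=> t0 xE.
have e0 : S t (fun=> 0) x = 0.
  have := semigroup_linear semiS 1 t0 (@within_cst 0) (@within_cst 0) xE.
  by rewrite (_ : (fun z => _) = fun=> 0); [lra | apply/funext => z; lra].
have := semigroup_linear semiS c t0 (@within_cst 1) (@within_cst 0) xE.
rewrite (semigroup_one semiS t0 xE) e0.
by rewrite (_ : (fun z => _) = fun=> c); [move->; lra | apply/funext => z; lra].
Qed.

Lemma semigroup_sub t (a : R) f g x : 0 <= t -> x \in E ->
  {within E, continuous f} -> {within E, continuous g} ->
  S t (fun z => g z - a * f z) x = S t g x - a * S t f x.
Proof.
move=> t0 xE cf cg; rewrite -mulNr addrC -(semigroup_linear semiS) //.
by congr (S t _ x); apply/funext => z; lra.
Qed.

Lemma semigroup_le t f g x : 0 <= t -> x \in E ->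
  {within E, continuous f} -> {within E, continuous g} ->
  (forall z, E z -> f z <= g z) -> S t f x <= S t g x.
Proof.
move=> t0 xE cf cg fg; rewrite -subr_ge0.
have -> : S t g x - S t f x = S t (fun z => g z - 1 * f z) x.
  by rewrite semigroup_sub // mul1r.
apply: (semigroup_positive semiS) => // [|z zE].
  rewrite (_ : (fun z => _) = fun z => -1 * f z + g z); first exact: within_lin.
  by apply/funext => z; lra.
by rewrite mul1r subr_ge0; apply: fg; exact: set_mem.
Qed.

Lemma semigroup_norm_le t f (e : R) x : 0 <= t -> x \in E ->
  {within E, continuous f} -> (forall z, E z -> `|f z| <= e) ->
  `|S t f x| <= e.
Proof.
move=> t0 xE cf fe; rewrite ler_norml; apply/andP; split.
  rewrite -[X in X <= _](semigroup_cst (- e) t0 xE).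
  by apply: semigroup_le => // z /fe; rewrite ler_norml => /andP[].
rewrite -[X in _ <= X](semigroup_cst e t0 xE).
by apply: semigroup_le => // z /fe; rewrite ler_norml => /andP[].
Qed.

(** The left side is [S t] applied to [S h f - f - h * L f]. Since [S t] contracts the supremum norm
    on [E], the uniform generator estimate at time 0 is carried to time [t] without loss. *)
Lemma semigroup_increment t h (e : R) f x : 0 <= t -> 0 < h -> x \in E ->
  {within E, continuous f} ->
  {in E, forall z, `|(S h f z - f z) / h - L f z| <= e} ->
  `|S (t + h) f x - S t f x - h * S t (L f) x| <= h * e.
Proof.
move=> t0 h0 xE cf fe.
have cSf := semigroup_continuous semiS (ltW h0) cf.
have [cLf _] := genS cf.
rewrite (semigroupD semiS t0 (ltW h0) cf xE).
have cd : {within E, continuous (fun z => S h f z - 1 * f z)}.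
  rewrite (_ : (fun z => _) = fun z => -1 * f z + S h f z); first exact: within_lin.
  by apply/funext => z; lra.
have -> : S t (S h f) x - S t f x - h * S t (L f) x =
    S t (fun z => (S h f z - 1 * f z) - h * L f z) x.
  by rewrite !semigroup_sub // mul1r.
apply: semigroup_norm_le => // [|z zE].
  rewrite (_ : (fun z => _) =
    fun z => - h * L f z + (S h f z - 1 * f z)); first exact: within_lin.
  by apply/funext => z; lra.
rewrite mul1r (_ : _ - _ = h * ((S h f z - f z) / h - L f z)); last first.
  by field; rewrite gt_eqF.
by rewrite normrM gtr0_norm // ler_pM2l // fe // inE.
Qed.

Lemma semigroup_modulus t h (e : R) f x : 0 <= t -> 0 <= h -> x \in E ->
  {within E, continuous f} ->
  {in E, forall z, `|S h f z - f z| <= e} ->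
  `|S (t + h) f x - S t f x| <= e.
Proof.
move=> t0 h0 xE cf fe.
have cSf := semigroup_continuous semiS h0 cf.
rewrite (semigroupD semiS t0 h0 cf xE).
have -> : S t (S h f) x - S t f x = S t (fun z => S h f z - 1 * f z) x.
  by rewrite semigroup_sub // mul1r.
apply: semigroup_norm_le => // [|z zE].
  rewrite (_ : (fun z => _) = fun z => -1 * f z + S h f z); first exact: within_lin.
  by apply/funext => z; lra.
by rewrite mul1r fe // inE.
Qed.

(** The forward equation at a fixed starting point: right increments come from
    [semigroup_increment], left ones need in addition the uniform continuity in time of
    [S t (L f)]. *)
Lemma semigroup_forward_derivable f x : x \in E -> {within E, continuous f} ->
  forward_derivable (fun t => S t f x) (fun t => S t (L f) x).
Proof.
move=> xE cf; have [cLf genf] := genS cf.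
split=> [t t0|]; last first.
  apply/cvgrPdist_le => e e0.
  near=> h; rewrite distrC.
  have -> : S h f x = S (0 + h) f x by rewrite add0r.
  apply: semigroup_modulus => //.
  near: h; exact: (semigroup_cvg0 semiS cf).
have lim : h^-1 *: (S (h *: 1 + t) f x - S t f x) @[h --> 0^'] --> S t (L f) x.
  apply/cvgrPdist_le => e e0.
  have e2 : 0 < e / 2 by rewrite divr_gt0.
  have [d1 /= d10 D1] := genf _ e2.
  have [d2 /= d20 D2] := semigroup_cvg0 semiS cLf e2.
  exists (Num.min t (Num.min d1 d2)); first by rewrite /= !lt_min t0 d10.
  move=> h /=; rewrite sub0r normrN !lt_min => /and3P[ht hd1 hd2] hN0.
  (* For [h < 0] the increment is taken forward from [t + h], which is nonnegative because
     [|h| < t]. It produces [S (t + h) (L f)], and [semigroup_modulus] moves this to time [t]; each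
     error takes half of [e]. *)
  have [h0|h0|h0] := ltrgtP h 0; last by rewrite h0 eqxx in hN0.
    have k0 : 0 < - h by rewrite oppr_gt0.
    have kd (d : R) : `|h| < d -> ball 0 d (- h).
      by rewrite /ball /= sub0r opprK.
    have tk : 0 <= t + h by move: ht; rewrite ltr0_norm //; lra.
    have := semigroup_increment tk k0 xE cf (D1 _ (kd _ hd1) k0).
    have := semigroup_modulus tk (ltW k0) xE cLf (D2 _ (kd _ hd2) k0).
    rewrite addrK [h *: 1]mulr1 (addrC h) => m2 m1.
    rewrite -(@ler_pM2l _ (- h)) // -[X in X * `|_|]gtr0_norm // -normrM.
    rewrite (_ : _ * (_ - _) = (- h) * (S t (L f) x - S (t + h) (L f) x) -
      (S t f x - S (t + h) f x - - h * S (t + h) (L f) x)); last first.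
      by rewrite /GRing.scale /=; field; rewrite lt_eqF.
    apply: le_trans (ler_normB _ _) _; rewrite normrM (gtr0_norm k0).
    have : - h * `|S t (L f) x - S (t + h) (L f) x| <= - h * (e / 2).
      by rewrite ler_pM2l.
    by move: m1; lra.
  have kd (d : R) : `|h| < d -> ball 0 d h by rewrite /ball /= sub0r normrN.
  have := semigroup_increment (ltW t0) h0 xE cf (D1 _ (kd _ hd1) h0).
  rewrite [h *: 1]mulr1 (addrC h) => m1.
  rewrite -(@ler_pM2l _ h) // -[X in X * `|_|]gtr0_norm // -normrM.
  rewrite (_ : _ * (_ - _) = - (S (t + h) f x - S t f x - h * S t (L f) x)).
    by rewrite normrN; apply: le_trans m1 _; rewrite ler_pM2l //; lra.
  by rewrite /GRing.scale /=; field; rewrite gt_eqF.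
apply: DeriveDef; first by apply/cvg_ex; exists (S t (L f) x).
exact: cvg_lim.
Unshelve. all: by end_near.
Qed.

End markov_semigroup.

(** The Markov property at time 0, tested on the sure event, and then the almost sure value of
    [Y 0]. From here on only the semigroup is used. *)
Lemma markov_jump_process_expectation (R : realType) (disp : measure_display)
    (Omega : measurableType disp) (P : probability Omega R)
    (X : topologicalType) (E : set X) (L : (X -> R) -> (X -> R)) (x0 : X)
    (Y : R -> Omega -> X) :
  E x0 -> markov_jump_process P E L x0 Y ->
  exists S : R -> (X -> R) -> (X -> R),
    [/\ markov_semigroup E S, has_generator E S L &
      forall (t : R) (f : X -> R), 0 <= t -> {within E, continuous f} ->
        'E_P[fun w => f (Y t w)]%E = (S t f x0)%:E].
Proof.
move=> Ex0 [mY YE Y0 _ [S [semiS genS markovS]]].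
exists S; split=> // t f t0 cf.
have := markovS 0 t f setT (lexx 0) t0 cf.
have FT : natural_filtration Y 0 [set: Omega].
  by rewrite -(setD0 setT); apply: sigma_algebraCD; exact: sigma_algebra0.
move=> /(_ FT); rewrite add0r unlock => ->.
have cSf := semigroup_continuous semiS t0 cf.
have mSf : measurable_fun [set: Omega] (fun w => S t f (Y 0 w)).
  apply: (measurability _ (measurable_realfun.RGenOpens.measurableE R)).
  move=> _ [_ [a [b ->]] <-]; rewrite setTI.
  have oab : open `]a, b[%classic by exact: interval_open.
  (* [S t f] is continuous only on [E], so the preimage of an interval is merely the trace on [E] of
     an open set. This suffices because [Y 0] takes all its values in [E]. *)
  move/continuousP: (cSf) => /(_ _ oab) /open_subspaceP [V oV VE].
  rewrite (_ : _ @^-1` _ = Y 0 @^-1` V); first exact: mY.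
  apply/seteqP; split=> w /= Yw.
    have : (V `&` E) (Y 0 w) by rewrite VE; split=> //; exact: YE.
    by case.
  have : (V `&` E) (Y 0 w) by split=> //; exact: YE.
  by rewrite VE => -[].
rewrite (@ae_eq_integral _ _ _ P setT (cst (S t f x0)%:E)) //.
- by rewrite integral_cst //= probability_setT mule1.
- exact/measurable_realfun.measurable_EFinP.
- by apply: filterS Y0 => w /= -> _.
Qed.

(** * Second moments of the averaging process *)

Lemma coordinate_continuous (R : realType) (d N : nat) (x : torus d N) :
  continuous (fun eta : config R d N => eta x).
Proof. by apply: (@proj_continuous (torus d N) (fun=> R) x). Qed.

Definition pairing (R : realType) (T : finType) (eta g : T -> R) : R :=
  \sum_z g z * eta z.

Definition torus_laplacian (R : realType) (d N : nat) (g : torus d N -> R)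
    (x : torus d N) : R :=
  2^-1 * \sum_(y : torus d N | torus_dist x y == 1%N) (g y - g x).

Section torus_dist.
Variables d N : nat.
Hypothesis N1 : (1 < N)%N.
Implicit Types x y : torus d N.

Lemma val_Zp_opp (k : 'Z_N) :
  nat_of_ord (- k)%R = (if k == 0%R :> 'Z_N then 0 else N - k)%N.
Proof.
have kN : (k < N)%N by rewrite -[X in (_ < X)%N](Zp_cast N1) ltn_ord.
have -> : nat_of_ord (- k)%R = ((N - k) %% N)%N.
  by congr ((_ - _) %% _)%N; exact: Zp_cast.
case: eqP => [-> | /eqP k0]; first by rewrite subn0 modnn.
have : (0 < k)%N by rewrite lt0n; apply: contraNneq k0 => k0; apply/eqP/val_inj.
by move=> ?; rewrite modn_small //; lia.
Qed.

Lemma torus_distC x y : torus_dist x y = torus_dist y x.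
Proof.
rewrite /torus_dist; apply: eq_bigr => i _.
rewrite -(opprB (y i)); set k := (y i - x i)%R.
have kN : (k < N)%N by rewrite -[X in (_ < X)%N](Zp_cast N1) ltn_ord.
by rewrite val_Zp_opp; case: eqP => [-> | _] //=; lia.
Qed.

Lemma torus_distxx x : torus_dist x x = 0%N.
Proof. by rewrite /torus_dist big1 // => i _; rewrite subrr min0n. Qed.

Lemma torus_dist1_neq x y : torus_dist x y == 1%N -> x != y.
Proof. by apply: contraTneq => ->; rewrite torus_distxx. Qed.

End torus_dist.

Section averaging_generator.
Variables (R : realType) (d N : nat).
Hypothesis N1 : (1 < N)%N.
Implicit Types (g : torus d N -> R) (eta : config R d N).

Lemma pairing_average g eta (x y : torus d N) : x != y ->
  pairing (average x y eta) g =
  pairing eta g - 2^-1 * ((eta x - eta y) * (g x - g y)).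
Proof.
move=> xy; rewrite /pairing (bigD1 x) //= (bigD1 y) 1?eq_sym //=.
rewrite [in RHS](bigD1 x) //= [in RHS](bigD1 y) 1?eq_sym //=.
rewrite /average !eqxx orbT /=.
rewrite (eq_bigr (fun z => g z * eta z)); first lra.
by move=> z /andP[/negPf -> /negPf ->].
Qed.

Lemma exchange_neighbours (F : torus d N -> torus d N -> R) :
  \sum_(x : torus d N) \sum_(y : torus d N | torus_dist x y == 1%N) F x y =
  \sum_(x : torus d N) \sum_(y : torus d N | torus_dist x y == 1%N) F y x.
Proof.
rewrite (exchange_big_dep predT) //=; apply: eq_bigr => x _.
by apply: eq_bigl => y; rewrite torus_distC.
Qed.

(** Summation by parts. The factor 4 is 2 for summing over ordered pairs times 2 for the half in
    [torus_laplacian]. *)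
Lemma sum_gradients g h :
  \sum_(x : torus d N) \sum_(y : torus d N | torus_dist x y == 1%N)
    (h x - h y) * (g x - g y) = - 4 * pairing h (torus_laplacian g).
Proof.
transitivity (2 * \sum_(x : torus d N) \sum_(y : torus d N | torus_dist x y == 1%N)
    h x * (g x - g y)).
  rewrite mulr_sumr; under [RHS]eq_bigr do rewrite mulr_sumr.
  have := exchange_neighbours (fun x y => h y * (g x - g y)); rewrite /= => e.
  under eq_bigr do under eq_bigr do rewrite mulrBl.
  under eq_bigr do rewrite sumrB.
  rewrite sumrB e -sumrB; apply: eq_bigr => x _.
  by rewrite -sumrB; apply: eq_bigr => y _; lra.
rewrite /pairing !mulr_sumr; apply: eq_bigr => x _.
rewrite /torus_laplacian -!mulrA mulr_suml !mulr_sumr.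
by apply: eq_bigr => y _; lra.
Qed.

(** With D = (eta x - eta y)(g x - g y), averaging over one edge changes the square of the pairing P
    by - P D + D^2 / 4. The linear parts add up to the Laplacian term by summation by parts. *)
Lemma averaging_generator_square g eta :
  averaging_generator (fun h : config R d N => pairing h g ^+ 2) eta =
  2 * (pairing eta g * pairing eta (torus_laplacian g)) +
  8^-1 * \sum_(x : torus d N) \sum_(y : torus d N | torus_dist x y == 1%N)
     (g x - g y) ^+ 2 * (eta x - eta y) ^+ 2.
Proof.
have := sum_gradients g eta; set G := pairing _ (torus_laplacian _) => e.
have -> : G = - 4^-1 * \sum_(x : torus d N)
  \sum_(y : torus d N | torus_dist x y == 1%N) (eta x - eta y) * (g x - g y).
  by rewrite e; lra.
rewrite /averaging_generator !mulr_sumr -big_split /=; apply: eq_bigr => x _.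
rewrite !mulr_sumr -big_split /=; apply: eq_bigr => y xy.
by rewrite pairing_average ?torus_dist1_neq //; lra.
Qed.

End averaging_generator.

Section second_moments.
Variables (R : realType) (d N : nat).
Hypothesis N1 : (1 < N)%N.
Let E := @prob_configs R d N.
Let L := @averaging_generator R d N.
Variable S : R -> (config R d N -> R) -> config R d N -> R.
Hypothesis semiS : markov_semigroup E S.
Hypothesis genS : has_generator E S L.
Variable eta0 : config R d N.
Hypothesis Eeta0 : E eta0.
Let M s f := S s f eta0.

(** Continuity and value are proved in one induction, since linearity of the semigroup is given for
    continuous functions only. *)
Lemma semigroup_sum (I : Type) (r : seq I) (P : pred I) (c : I -> R)
    (f : I -> config R d N -> R) (s : R) :
  0 <= s -> (forall i, {within E, continuous (f i)}) ->
  {within E, continuous (fun eta => \sum_(i <- r | P i) c i * f i eta)} /\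
  M s (fun eta => \sum_(i <- r | P i) c i * f i eta) =
  \sum_(i <- r | P i) c i * M s (f i).
Proof.
move=> s0 cf; have E0 := mem_set Eeta0.
elim: r => [|i r [IHc IH]].
  rewrite big_nil (_ : (fun _ => _) = fun=> 0); last first.
    by apply/funext => eta; rewrite big_nil.
  by split; [move=> x; exact: cvg_cst|exact: (semigroup_cst semiS)].
rewrite (_ : (fun _ => _) = fun eta => (if P i then c i else 0) * f i eta +
  \sum_(j <- r | P j) c j * f j eta); last first.
  by apply/funext => eta; rewrite big_cons; case: ifP; rewrite // mul0r add0r.
split.
  move=> x; apply: cvgD; last exact: IHc.
  by apply: cvgM; [exact: cvg_cst|exact: cf].
rewrite [LHS](semigroup_linear semiS _ s0 (cf i) IHc E0) [X in _ + X]IH big_cons.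
by case: ifP; rewrite // mul0r add0r.
Qed.

Let coord2_continuous (z w : torus d N) :
  {within E, continuous (fun eta : config R d N => eta z * eta w)}.
Proof.
apply: continuous_subspaceT => eta.
exact: (cvgM (coordinate_continuous (x := z) (x0 := eta))
  (coordinate_continuous (x := w) (x0 := eta))).
Qed.

Definition second_moment (s : R) (z w : torus d N) : R :=
  M s (fun eta => eta z * eta w).

Lemma semigroup_pairing (s : R) (g h : torus d N -> R) : 0 <= s ->
  {within E, continuous (fun eta => pairing eta g * pairing eta h)} /\
  M s (fun eta => pairing eta g * pairing eta h) =
  \sum_z \sum_w g z * h w * second_moment s z w.
Proof.
move=> s0.
rewrite pair_big_dep /=.
have [c e] := @semigroup_sum _ (index_enum _) xpredT
  (fun p : torus d N * torus d N => g p.1 * h p.2)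
  (fun p eta => eta p.1 * eta p.2) s s0 (fun p => @coord2_continuous p.1 p.2).
rewrite (_ : (fun _ => _ * _) = fun eta : config R d N =>
  \sum_(p : torus d N * torus d N) g p.1 * h p.2 * (eta p.1 * eta p.2)) //.
apply/funext => eta; rewrite /pairing big_distrlr /= pair_big_dep /=.
by apply: eq_bigr => p _; lra.
Qed.

Lemma second_momentC (s : R) (z w : torus d N) :
  second_moment s z w = second_moment s w z.
Proof. by congr (M s _); apply/funext => eta; rewrite mulrC. Qed.

Lemma second_moment_forward_derivable (z w : torus d N) :
  forward_derivable (fun s => second_moment s z w)
    (fun s => M s (L (fun eta => eta z * eta w))).
Proof.
apply: (semigroup_forward_derivable semiS genS (mem_set Eeta0)).
exact: coord2_continuous.
Qed.

Definition gradient_moment (s : R) (x y : torus d N) : R :=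
  M s (fun eta => (eta x - eta y) ^+ 2).

(** Written through the finite matrix of second moments so that a test function [g] moving with time
    can be differentiated entry by entry with the product rule. *)
Definition pairing_moment (s : R) (g : torus d N -> R) : R :=
  \sum_z \sum_w g z * g w * second_moment s z w.

Lemma pairing_momentE (s : R) (g : torus d N -> R) : 0 <= s ->
  {within E, continuous (fun eta => pairing eta g ^+ 2)} /\
  M s (fun eta => pairing eta g ^+ 2) = pairing_moment s g.
Proof. by move=> s0; have [c e] := semigroup_pairing g g s0; split. Qed.

Lemma gradient_continuous (x y : torus d N) :
  {within E, continuous (fun eta : config R d N => (eta x - eta y) ^+ 2)}.
Proof.
apply: continuous_subspaceT => eta.
have c := cvgB (coordinate_continuous (x := x) (x0 := eta))
  (coordinate_continuous (x := y) (x0 := eta)).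
exact: (cvgM (c _) (c _)).
Qed.

(** [L] is linear, so the generators of the products [eta z * eta w] recombine inside the
    expectation into the generator of the squared pairing, where [averaging_generator_square]
    applies. *)
Lemma semigroup_generator_square (s : R) (g : torus d N -> R) : 0 <= s ->
  \sum_z \sum_w g z * g w * M s (L (fun eta => eta z * eta w)) =
  2 * (\sum_z \sum_w g z * torus_laplacian g w * second_moment s z w) +
  8^-1 * \sum_(x : torus d N) \sum_(y : torus d N | torus_dist x y == 1%N)
    (g x - g y) ^+ 2 * gradient_moment s x y.
Proof.
move=> s0.
have cL (p : torus d N * torus d N) :
    {within E, continuous (L (fun eta => eta p.1 * eta p.2))}.
  by have [] := genS (@coord2_continuous p.1 p.2).
rewrite pair_big_dep /= pair_big_dep /= [X in 8^-1 * X]pair_big_dep /=.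
have [_ <-] := @semigroup_sum _ (index_enum _) xpredT
  (fun p : torus d N * torus d N => g p.1 * g p.2) _ s s0 cL.
have [c1 e1] := semigroup_pairing g (torus_laplacian g) s0.
have [c2 <-] := @semigroup_sum _ (index_enum _)
  (fun p : torus d N * torus d N => torus_dist p.1 p.2 == 1%N)
  (fun p : torus d N * torus d N => (g p.1 - g p.2) ^+ 2) _ s s0
  (fun p => @gradient_continuous p.1 p.2).
rewrite pair_big_dep /= in e1; rewrite -e1 addrC.
have zc : {within E, continuous (fun _ : config R d N => 0 : R)}.
  by move=> ?; exact: cvg_cst.
have lin := semigroup_linear semiS _ s0 _ _ (mem_set Eeta0).
have z0 : M s (fun=> 0) = 0 by apply: (semigroup_cst semiS) => //; exact: mem_set.
(* The [+ 0] gives the function the shape [a * f + g] in which linearity of the semigroup is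
   stated. *)
have e2 : 2 * M s (fun eta => pairing eta g * pairing eta (torus_laplacian g)) =
  M s (fun eta => 2 * (pairing eta g * pairing eta (torus_laplacian g)) + 0).
  by rewrite [RHS](lin 2 _ _ c1 zc) [X in _ + X]z0 addr0.
have c3 : {within E, continuous (fun eta : config R d N =>
    2 * (pairing eta g * pairing eta (torus_laplacian g)) + 0)}.
  move=> eta; apply: cvgD; last exact: cvg_cst.
  by apply: cvgM; [exact: cvg_cst | exact: c1].
rewrite e2 -[RHS](lin 8^-1 _ _ c2 c3); congr (M s _); apply/funext => eta.
have av := averaging_generator_square N1 g eta.
rewrite pair_big_dep /= in av; rewrite addr0 addrC -av.
rewrite /L /averaging_generator; under eq_bigr do rewrite mulrCA.
rewrite -mulr_sumr; congr (_ * _).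
under eq_bigr do rewrite mulr_sumr.
rewrite exchange_big /=; apply: eq_bigr => x _.
under eq_bigr do rewrite mulr_sumr.
rewrite exchange_big /=; apply: eq_bigr => y _.
have sq (h : config R d N) : pairing h g ^+ 2 =
    \sum_(p : torus d N * torus d N) g p.1 * g p.2 * (h p.1 * h p.2).
  rewrite expr2 /pairing big_distrlr /= pair_big_dep /=.
  by apply: eq_bigr => p _; lra.
by rewrite !sq -sumrB; apply: eq_bigr => p _; lra.
Qed.

(** Applied twice: to the backward heat flow, where [k = 0] and only the gradient term survives, and
    to exponentially weighted Fourier modes, where [k] is [beta / 2] minus the symbol. *)
Lemma pairing_moment_forward_derivable (g dg : R -> torus d N -> R) (k : R) :
  (forall z, forward_derivable (g ^~ z) (dg ^~ z)) ->
  (forall (s : R) z, 0 < s -> dg s z + torus_laplacian (g s) z = k * g s z) ->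
  forward_derivable (fun s => pairing_moment s (g s))
    (fun s => 2 * k * pairing_moment s (g s) +
       8^-1 * \sum_(x : torus d N) \sum_(y : torus d N | torus_dist x y == 1%N)
          (g s x - g s y) ^+ 2 * gradient_moment s x y).
Proof.
move=> dgP eqg.
have H : forward_derivable (fun s => pairing_moment s (g s)) (fun s =>
  \sum_z \sum_w ((dg s z * g s w + g s z * dg s w) * second_moment s z w +
    g s z * g s w * M s (L (fun eta => eta z * eta w)))).
  apply: forward_derivable_sum => z _; apply: forward_derivable_sum => w _.
  apply: forward_derivableM; last exact: second_moment_forward_derivable.
  exact: forward_derivableM.
apply: (forward_derivable_ext H) => s s0.
under eq_bigr do rewrite big_split /=.
rewrite big_split /= semigroup_generator_square ?ltW // addrA; congr (_ + _).
have sym : \sum_z \sum_w dg s z * g s w * second_moment s z w =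
    \sum_z \sum_w g s z * dg s w * second_moment s z w.
  rewrite exchange_big; apply: eq_bigr => z _; apply: eq_bigr => w _.
  by rewrite second_momentC; congr (_ * _); rewrite mulrC.
under eq_bigr do under eq_bigr do rewrite mulrDl.
under eq_bigr do rewrite big_split /=.
rewrite big_split /= sym.
rewrite (_ : forall a b : R, a + a + 2 * b = 2 * (a + b)); last by move=> *; lra.
rewrite -mulrA; congr (_ * _).
rewrite /pairing_moment mulr_sumr -big_split; apply: eq_bigr => z _ /=.
rewrite mulr_sumr -big_split; apply: eq_bigr => w _ /=.
by rewrite -mulrDl -mulrDr eqg // !mulrA [g s z * k]mulrC.
Qed.

End second_moments.

(** * Fourier analysis on the torus *)

Section circle.
Context {R : realType} {N : nat}.
Hypothesis N1 : (1 < N)%N.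
Implicit Types a b : 'Z_N.

Lemma sin_le_id (x : R) : 0 <= x -> sin x <= x.
Proof.
move=> x0.
have h := @forward_derivable_le R sin id cos (fun=> 1) 0 x.
have := h; rewrite sin0 !subr0; apply.
- by apply: forward_derivable_everywhere => s; exact: is_derive_sin.
- by apply: forward_derivable_everywhere => s; exact: is_derive_id.
- by rewrite lexx.
- by move=> s _; exact: cos_le1.
Qed.

Lemma cos_piquarter_ge : 2^-1 <= cos (pi / 4 : R).
Proof.
have c0 : 0 <= cos (pi / 4 : R).
  by apply: cos_ge0_pihalf; have := @pi_ge0 R; lra.
have := @cos_mulr2n R (pi / 4).
rewrite (_ : (pi / 4) *+ 2 = pi / 2); last by rewrite -mulr_natl; lra.
rewrite cos_pihalf => /eqP; rewrite eq_sym subr_eq add0r -mulr_natl => /eqP e.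
by rewrite leNgt; apply/negP => lt; nra.
Qed.

(** A crude Jordan inequality. Up to [pi / 4] the derivative of sine is at least 1/2; beyond, sine
    is at least 1/2 by monotonicity while [x / 4] is below 1/2 because [pi < 4]. *)
Lemma sin_ge_quarter (x : R) : 0 <= x <= pi / 2 -> x / 4 <= sin x.
Proof.
move=> /andP[x0 x1]; have p2 := @pi_ge2 R; have p4 := @pihalf_lt2 R.
have [xp|px] := leP x (pi / 4); last first.
  have : sin (pi / 4) <= sin x.
    by rewrite leNgt ltr_sin ?in_itv /= -?leNgt; first (by lra); apply/andP; split; lra.
  have -> : sin (pi / 4 : R) = cos (pi / 4).
    by rewrite -cosBpihalf -cosN; congr cos; lra.
  by have := cos_piquarter_ge; lra.
have h := @forward_derivable_le R (fun x => 2^-1 * x) sin (fun=> 2^-1 * 1) cos 0 x.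
have : 2^-1 * x - 2^-1 * 0 <= sin x - sin 0.
  apply: h.
  - by apply: forward_derivableZ; apply: forward_derivable_everywhere => s;
      exact: is_derive_id.
  - by apply: forward_derivable_everywhere => s; exact: is_derive_sin.
  - by rewrite lexx.
  - move=> s /andP[s0 sx]; rewrite mulr1; apply: le_trans cos_piquarter_ge _.
    by rewrite leNgt ltr_cos ?in_itv /= -?leNgt; first (by lra); apply/andP; split; lra.
by rewrite sin0; lra.
Qed.

Definition angle a : R := 2 * pi / N%:R * (a : nat)%:R.
Definition cosZ a : R := cos (angle a).
Definition sinZ a : R := sin (angle a).

Let N0 : N%:R != 0 :> R. Proof. by rewrite pnatr_eq0; lia. Qed.
Let NZ : (Zp_trunc N).+2 = N. Proof. exact: Zp_cast. Qed.

Lemma angle_mod (n : nat) : exists m : nat,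
  2 * pi / N%:R * n%:R = 2 * pi / N%:R * (n %% N)%:R + (pi *+ 2) *+ m :> R.
Proof.
have e : n%:R = (n %/ N)%:R * N%:R + (n %% N)%:R :> R.
  by rewrite -natrM -natrD -divn_eq.
exists (n %/ N)%N; rewrite e -(mulr_natr (pi *+ 2) (n %/ N)) -(mulr_natr pi 2).
by move: pi (n %/ N)%:R (n %% N)%:R N%:R N0 => p q r M M0; field.
Qed.

Lemma angleD a b : exists m : nat, angle a + angle b = angle (a + b) + (pi *+ 2) *+ m.
Proof.
have [m e] := angle_mod (a + b)%N; exists m.
have -> : angle (a + b) = 2 * pi / N%:R * ((a + b) %% N)%N%:R.
  by rewrite /angle; congr (_ * _%:R); congr (_ %% _)%N.
by rewrite -e /angle natrD [RHS]mulrDr.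
Qed.

Lemma cosZD a b : cosZ (a + b) = cosZ a * cosZ b - sinZ a * sinZ b.
Proof.
rewrite -cosD; have [m ->] := angleD a b.
by rewrite (periodicn (@cosD2pi R)).
Qed.

Lemma sinZD a b : sinZ (a + b) = sinZ a * cosZ b + cosZ a * sinZ b.
Proof.
rewrite -sinD; have [m ->] := angleD a b.
by rewrite (periodicn (@sinD2pi R)).
Qed.

Lemma cosZ0 : cosZ 0 = 1. Proof. by rewrite /cosZ /angle mulr0 cos0. Qed.
Lemma sinZ0 : sinZ 0 = 0. Proof. by rewrite /sinZ /angle mulr0 sin0. Qed.

Lemma cosZ2DsinZ2 a : cosZ a ^+ 2 + sinZ a ^+ 2 = 1. Proof. exact: cos2Dsin2. Qed.

Lemma cosZ_le1 a : cosZ a <= 1. Proof. exact: cos_le1. Qed.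

(** [angle (- a)] equals [- angle a] only modulo [2 * pi]. Instead, the addition formulas at
    [a + (- a) = 0] form a linear system with a rotation as matrix, which is inverted. *)
Lemma cosZN a : cosZ (- a) = cosZ a.
Proof.
have := cosZD a (- a); have := sinZD a (- a); rewrite subrr cosZ0 sinZ0.
have := cosZ2DsinZ2 a; set c := cosZ a; set s := sinZ a.
set C := cosZ (- a); set S := sinZ (- a) => e1 e2 e3.
transitivity (c * (c * C - s * S) + s * (s * C + c * S)).
  by rewrite -[LHS]mulr1 -e1; ring.
by rewrite -e2 -e3; ring.
Qed.

Lemma sinZN a : sinZ (- a) = - sinZ a.
Proof.
have := cosZD a (- a); have := sinZD a (- a); rewrite subrr cosZ0 sinZ0.
have := cosZ2DsinZ2 a; set c := cosZ a; set s := sinZ a.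
set C := cosZ (- a); set S := sinZ (- a) => e1 e2 e3.
transitivity (c * (s * C + c * S) - s * (c * C - s * S)).
  by rewrite -[LHS]mulr1 -e1; ring.
by rewrite -e2 -e3; ring.
Qed.

Lemma cosZB a b : cosZ (a - b) = cosZ a * cosZ b + sinZ a * sinZ b.
Proof. by rewrite cosZD cosZN sinZN mulrN opprK. Qed.

Definition zabs a : nat := minn a (N - a).

Lemma zabs_le a : (2 * zabs a <= N)%N.
Proof. by rewrite /zabs; lia. Qed.

Lemma ltn_Z a : (a < N)%N.
Proof. by rewrite -[X in (_ < X)%N]NZ ltn_ord. Qed.

Lemma cosZ_zabs a : cosZ a = cos (2 * (pi / N%:R * (zabs a)%:R)).
Proof.
have aN := ltn_Z a.
rewrite /cosZ /angle /zabs; case: (leqP a (N - a)) => h.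
  by congr cos; move: N0; set M := N%:R => M0; field.
rewrite natrB 1?ltnW // -[RHS]cosN -[RHS]cosD2pi; congr cos.
by rewrite -(mulr_natr pi 2); move: N0; set M := N%:R => M0; field.
Qed.

Lemma one_sub_cosZ a : 1 - cosZ a = 2 * sin (pi / N%:R * (zabs a)%:R) ^+ 2.
Proof.
rewrite cosZ_zabs mulr_natl cos_mulr2n -mulr_natl cos2sin2; lra.
Qed.

Let zangle a : (0 : R) <= (pi : R) / N%:R * (zabs a)%:R <= pi / 2.
Proof.
rewrite mulr_ge0 ?divr_ge0 ?pi_ge0 //= -mulrA ler_pM2l ?pi_gt0 //.
rewrite ler_pdivrMl ?ltr0n ?(ltnW N1) // ler_pdivlMr // -natrM ler_nat mulnC.
exact: zabs_le.
Qed.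

(** Half the angle lies in [0, pi/2], where sine is at least a quarter of its argument; [pi >= 2]
    gives the constant. *)
Lemma one_sub_cosZ_ge a : (zabs a)%:R ^+ 2 / (2 * N%:R ^+ 2) <= 1 - cosZ a.
Proof.
rewrite one_sub_cosZ; have := sin_ge_quarter (zangle a).
have /andP[z0 _] := zangle a.
have h : (zabs a)%:R / (2 * N%:R) <= pi / N%:R * (zabs a)%:R / 4 :> R.
  rewrite (_ : _ / (2 * _) = 2 / N%:R * (zabs a)%:R / 4); last by field.
  by rewrite ler_pM2r // ler_wpM2r // ler_wpM2r ?invr_ge0 // pi_ge2.
move=> /(le_trans h) {}h.
have -> : (zabs a)%:R ^+ 2 / (2 * N%:R ^+ 2) = 2 * ((zabs a)%:R / (2 * N%:R)) ^+ 2 :> R.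
  by field.
rewrite ler_pM2l // lerXn2r // nnegrE.
  by rewrite divr_ge0 // mulr_ge0.
by apply: le_trans h; rewrite divr_ge0 // mulr_ge0.
Qed.

(** Sine is below its argument and [pi < 4], so 32 is 2 * 4^2. *)
Lemma one_sub_cosZ_le a : 1 - cosZ a <= 32 * (zabs a)%:R ^+ 2 / N%:R ^+ 2.
Proof.
rewrite one_sub_cosZ; have /andP[z0 z1] := zangle a.
have s0 : 0 <= sin (pi / N%:R * (zabs a)%:R) :> R.
  by apply: sin_ge0_pi; rewrite z0 /=; have := @pi_ge0 R; lra.
have h := sin_le_id z0.
have h2 : pi / N%:R * (zabs a)%:R <= 4 / N%:R * (zabs a)%:R :> R.
  by rewrite ler_wpM2r // ler_wpM2r ?invr_ge0 //; have := @pihalf_lt2 R; lra.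
have -> : 32 * (zabs a)%:R ^+ 2 / N%:R ^+ 2 = 2 * (4 / N%:R * (zabs a)%:R) ^+ 2 :> R.
  by field.
rewrite ler_pM2l // lerXn2r // ?nnegrE.
  exact: le_trans (le_trans s0 h) h2.
exact: le_trans h h2.
Qed.

Lemma zabs_eq0 a : (zabs a == 0)%N = (a == 0).
Proof.
have aN := ltn_Z a; apply/idP/eqP => [h|->]; last by rewrite /zabs min0n.
by apply/val_inj; rewrite /= /zabs in h *; lia.
Qed.

Lemma zabs_eq1 a : (zabs a == 1)%N = (a == 1) || (a == -1).
Proof.
have aN := ltn_Z a.
have v1 : nat_of_ord (1 : 'Z_N) = 1%N by rewrite /= NZ modn_small.
have vN1 : nat_of_ord (-1 : 'Z_N) = (N - 1)%N.
  by rewrite val_Zp_opp // v1 oner_eq0.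
apply/idP/orP => [h|[/eqP ->|/eqP ->]]; last 2 first.
- by rewrite /zabs v1; apply/eqP/minn_idPl; lia.
- by rewrite /zabs vN1; apply/eqP; lia.
case: (leqP a (N - a)) => h'; [left|right]; apply/eqP/val_inj => /=.
  by rewrite -[RHS]/(nat_of_ord (1 : 'Z_N)) v1; rewrite /zabs in h; lia.
by rewrite -[RHS]/(nat_of_ord (-1 : 'Z_N)) vN1; rewrite /zabs in h; lia.
Qed.

Lemma cosZ1 : cosZ 1 = cos (2 * pi / N%:R).
Proof. by rewrite /cosZ /angle [nat_of_ord _]/= NZ modn_small // mulr1. Qed.

(** By monotonicity the left side is compared with twice the basic angle, where 1 - cos equals 2 (1
    - c)(1 + c) with c = [cosZ 1]. This is at least 2 (1 - c) as soon as c is nonnegative, which is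
    what [4 <= N] provides. *)
Lemma one_sub_cosZ_ge2 a : (4 <= N)%N -> (1 < zabs a)%N ->
  2 * (1 - cosZ 1) <= 1 - cosZ a.
Proof.
move=> N4 a2.
have n0 : 0 < N%:R :> R by rewrite ltr0n; lia.
have p0 := @pi_gt0 R.
have n4 : 4 <= N%:R :> R by rewrite (ler_nat _ 4 N).
have /andP[z0 z1] := zangle a.
have h : cosZ a <= cos (2 * pi / N%:R *+ 2).
  have q : 2 * pi / N%:R *+ 2 <= 2 * (pi / N%:R * (zabs a)%:R) :> R.
    rewrite (_ : _ *+ 2 = 2 * (pi / N%:R * 2)); last by rewrite -mulr_natl; field.
    by rewrite ler_pM2l // ler_pM2l ?divr_gt0 // (ler_nat _ 2 (zabs a)).
  rewrite cosZ_zabs leNgt ltr_cos ?in_itv /= -?leNgt //.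
  - by apply/andP; split; lra.
  - by apply/andP; split; [rewrite mulrn_wge0 // divr_ge0 // mulr_ge0 // ltW | lra].
have c0 : 0 <= cosZ 1.
  rewrite cosZ1; apply: cos_ge0_pihalf; apply/andP; split.
    by apply: (@le_trans _ _ 0); [lra | rewrite divr_ge0 // mulr_ge0 //; exact: ltW].
  by rewrite ler_pdivrMr //; nra.
have := cosZ_le1 1; move: h; rewrite cos_mulr2n -cosZ1 -mulr_natl; nra.
Qed.

End circle.

Section torus_fourier.
Variables (R : realType) (d N : nat).
Hypothesis N4 : (3 < N)%N.
Implicit Types x y k : torus d N.

Let N1 : (1 < N)%N. Proof. exact: leq_trans N4. Qed.
Let cosZ := @cosZ R N.
Let sinZ := @sinZ R N.

Definition step x (j : 'I_d) (a : 'Z_N) : torus d N :=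
  [ffun i => x i + (if i == j then a else 0)].

Lemma stepK j a : cancel (fun x => step x j a) (fun x => step x j (- a)).
Proof.
by move=> x; apply/ffunP => i; rewrite !ffunE; case: eqP => _; rewrite ?addrK // !addr0.
Qed.

Let one_neqN1 : (1 : 'Z_N) != -1.
Proof.
apply/eqP => e; have := congr1 (fun a : 'Z_N => nat_of_ord a) e.
rewrite val_Zp_opp // oner_eq0 /= Zp_cast // modn_small //; lia.
Qed.

Lemma torus_dist_step x j a :
  torus_dist x (step x j a) = zabs a.
Proof.
rewrite /torus_dist (bigD1 j) // big1 => [|i /andP[_ /negPf ij]].
  rewrite [LHS]addn0 ffunE eqxx opprD addNKr /zabs val_Zp_opp //.
  have := ltn_Z N1 a; case: eqP => [->|_] /=; first by rewrite !min0n.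
  by lia.
by rewrite ffunE ij addr0 subrr min0n.
Qed.

Lemma zabs1 : zabs (1 : 'Z_N) = 1%N.
Proof. by apply/eqP; rewrite zabs_eq1 // eqxx. Qed.

Lemma zabsN1 : zabs (-1 : 'Z_N) = 1%N.
Proof. by apply/eqP; rewrite zabs_eq1 // eqxx orbT. Qed.

Lemma step_inj x j i a b : a != 0 -> step x j a = step x i b -> j = i /\ a = b.
Proof.
move=> a0 /ffunP /(_ j); rewrite !ffunE eqxx => /addrI.
by case: eqP => [-> -> //|_ e]; rewrite e eqxx in a0.
Qed.

Lemma torus_dist1P x y : torus_dist x y == 1%N ->
  exists (j : 'I_d) (a : 'Z_N), (a = 1 \/ a = -1) /\ y = step x j a.
Proof.
pose D i : 'Z_N := x i - y i.
have -> : torus_dist x y = (\sum_(i < d) zabs (D i))%N by [].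
move=> /eqP e.
have [j j0] : exists j, (0 < zabs (D j))%N.
  apply/existsP; apply: contra_eqT e; rewrite negb_exists => /forallP h.
  by rewrite big1 // => i _; apply/eqP; move: (h i); rewrite -leqNgt leqn0.
rewrite (bigD1 j) //= in e.
have j1 : zabs (D j) == 1%N by apply/eqP; lia.
have e0 : (\sum_(i < d | i != j) zabs (D i) == 0)%N.
  by apply/eqP; move: e; rewrite (eqP j1) => -[].
move: e0; rewrite sum_nat_eq0 => /forallP e0.
exists j, (y j - x j); split.
  move: j1; rewrite zabs_eq1 // => /orP[] /eqP h.
    by right; rewrite -opprB -/(D j) h.
  by left; rewrite -opprB -/(D j) h opprK.
apply/ffunP => i; rewrite ffunE; case: eqP => [->|/eqP ij].
  by rewrite addrCA subrr addr0.
move: (implyP (e0 i) ij); rewrite zabs_eq0 // subr_eq0 => /eqP ->.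
by rewrite addr0.
Qed.

(** The listed points are pairwise distinct because 1 and -1 differ modulo [N], so their indicators
    add up to the indicator of the neighbourhood. *)
Lemma sum_neighbours x (h : torus d N -> R) :
  \sum_(y : torus d N | torus_dist x y == 1%N) h y =
  \sum_(j < d) (h (step x j 1) + h (step x j (-1))).
Proof.
have ind y : (torus_dist x y == 1%N)%:R =
    \sum_(j < d) ((y == step x j 1)%:R + (y == step x j (-1))%:R) :> R.
  case: eqP => [/eqP/torus_dist1P[j [a [a1 ->]]]|ne].
    rewrite (bigD1 j) //= big1 => [|i ij]; last first.
      have no b : (step x j a == step x i b) = false.
        apply/negP => /eqP /step_inj[|ji _]; first by case: a1 => ->; rewrite ?oppr_eq0.
        by rewrite ji eqxx in ij.
      by rewrite !no addr0.
    have no : (step x j 1 == step x j (-1)) = false.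
      by apply/negP => /eqP /step_inj[|_ /eqP] //; rewrite (negPf one_neqN1).
    by case: a1 => ->; rewrite eqxx ?no ?[_ == step x j 1]eq_sym ?no /= !addr0 ?add0r.
  rewrite big1 // => j _.
  have no a : zabs a = 1%N -> (y == step x j a) = false.
    by move=> a1; apply/negP => /eqP e; apply: ne; rewrite e torus_dist_step.
  by rewrite !no ?zabs1 ?zabsN1 // addr0.
rewrite big_mkcond /=.
transitivity (\sum_(y : torus d N) \sum_(j < d)
    ((y == step x j 1)%:R * h y + (y == step x j (-1))%:R * h y)).
  apply: eq_bigr => y _.
  have -> : (if torus_dist x y == 1%N then h y else 0) = (torus_dist x y == 1%N)%:R * h y.
    by case: eqP; rewrite ?mul1r ?mul0r.
  by rewrite ind mulr_suml; apply: eq_bigr => j _; rewrite mulrDl.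
have pick z : \sum_(y : torus d N) (y == z)%:R * h y = h z.
  rewrite (bigD1 z) //= eqxx mul1r big1 ?addr0 // => y /negPf ->.
  by rewrite mul0r.
rewrite exchange_big; apply: eq_bigr => j _ /=.
by rewrite big_split /= !pick.
Qed.

Definition phase k x : 'Z_N := \sum_(j < d) k j * x j.

Lemma phaseC k x : phase k x = phase x k.
Proof. by apply: eq_bigr => j _; rewrite mulrC. Qed.

Lemma phase_step k x j a : phase k (step x j a) = phase k x + k j * a.
Proof.
rewrite /phase; under eq_bigr do rewrite ffunE mulrDr.
rewrite big_split /=; congr (_ + _).
rewrite (bigD1 j) //= eqxx big1 ?addr0 // => i /negPf ->.
by rewrite mulr0.
Qed.

Definition symbol k : R := \sum_(j < d) (1 - cosZ (k j)).

(** Imaginary and real part of the character with frequency [k]. Summing products over [b] replaces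
    multiplication by a complex conjugate. *)
Definition wave (b : bool) k x : R :=
  if b then sinZ (phase k x) else cosZ (phase k x).

Lemma torus_laplacian_wave b k x :
  torus_laplacian (wave b k) x = - symbol k * wave b k x.
Proof.
rewrite /torus_laplacian (sum_neighbours x (fun y => wave b k y - wave b k x)).
rewrite /symbol mulr_sumr -sumrN mulr_suml; apply: eq_bigr => j _.
rewrite /wave !phase_step mulr1 mulrN1.
case: b; rewrite ?/sinZ ?/cosZ ?sinZD ?cosZD // ?sinZN ?cosZN //; lra.
Qed.

Lemma sum_wave k x y :
  \sum_b wave b k x * wave b k y = cosZ (phase k x - phase k y).
Proof. by rewrite big_bool /= addrC -cosZB. Qed.

Lemma sum_wave_sqr k x : \sum_b wave b k x ^+ 2 = 1.
Proof. by rewrite big_bool /= addrC -[RHS](cosZ2DsinZ2 (phase k x)). Qed.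

Lemma sum_wave_gradient k x y :
  \sum_b (wave b k x - wave b k y) ^+ 2 = 2 * (1 - cosZ (phase k x - phase k y)).
Proof.
rewrite -sum_wave; transitivity (\sum_b wave b k x ^+ 2 + \sum_b wave b k y ^+ 2 -
  2 * \sum_b wave b k x * wave b k y); last by rewrite !sum_wave_sqr; lra.
by rewrite !big_bool /=; lra.
Qed.

Lemma phase_step_sub k x j a : cosZ (phase k x - phase k (step x j a)) = cosZ (k j * a).
Proof. by rewrite phase_step opprD addNKr /cosZ cosZN. Qed.

Lemma wave_orthogonal x y :
  \sum_k cosZ (phase k x - phase k y) = (N ^ d)%:R * (x == y)%:R.
Proof.
case: eqP => [->|/eqP xy].
  rewrite mulr1; under eq_bigr do rewrite subrr /cosZ cosZ0.
  by rewrite sumr_const cardT -cardE card_ffun !card_ord Zp_cast.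
have [j xyj] : exists j, x j != y j.
  by apply/existsP; apply: contraNT xy; rewrite -negb_forall negbK => /eqfunP/ffunP ->.
rewrite mulr0; set th := x j - y j; set X := \sum_k _.
pose Y := \sum_k sinZ (phase k x - phase k y).
have c1 : 1 - cosZ th != 0.
  rewrite gt_eqF //; apply: lt_le_trans (@one_sub_cosZ_ge R N N1 th).
  rewrite divr_gt0 ?mulr_gt0 ?exprn_gt0 ?ltr0n ?lt0n ?zabs_eq0 ?subr_eq0 //; lia.
(* Translating the frequency by a unit vector rotates [(X, Y)] by the angle of
   [th], which is not a multiple of [2 pi]. *)
have st k : phase (step k j 1) x - phase (step k j 1) y = (phase k x - phase k y) + th.
  by rewrite !(phaseC _ x) !(phaseC _ y) !phase_step !mulr1 /th; ring.
have re (F : torus d N -> R) : \sum_k F k = \sum_k F (step k j 1).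
  rewrite (reindex (fun k => step k j 1)) //; apply: onW_bij.
  exists (fun k => step k j (-1)); first exact: stepK.
  by move=> k; rewrite -[in X in step _ _ X](opprK 1); exact: stepK.
have eX : X = cosZ th * X - sinZ th * Y.
  rewrite {1}/X re !mulr_sumr -sumrB; apply: eq_bigr => k _.
  by rewrite st /cosZ /sinZ cosZD //; ring.
have eY : Y = sinZ th * X + cosZ th * Y.
  rewrite {1}/Y re !mulr_sumr -big_split; apply: eq_bigr => k _.
  by rewrite st /cosZ /sinZ sinZD //=; ring.
(* Eliminating [Y] leaves the factor (1 - c)^2 + s^2 = 2 (1 - c) in front of [X]. *)
have e2 : (1 - cosZ th) * (2 * X) = 0.
  have := cosZ2DsinZ2 th; rewrite -/cosZ -/sinZ => e.
  transitivity ((1 - cosZ th) * (X - (cosZ th * X - sinZ th * Y)) +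
    sinZ th * ((sinZ th * X + cosZ th * Y) - Y) +
    (1 - (cosZ th ^+ 2 + sinZ th ^+ 2)) * X); first ring.
  by rewrite -eX -eY e !subrr; ring.
by move/eqP: e2; rewrite mulf_eq0 (negPf c1) /= mulf_eq0 pnatr_eq0 /= => /eqP.
Qed.

End torus_fourier.

(** * Heat kernel bounds *)

Section circle_sums.
Context {R : realType} {N : nat}.
Hypothesis N4 : (3 < N)%N.
Implicit Types a : 'Z_N.
Let N1 : (1 < N)%N. Proof. exact: leq_trans N4. Qed.
Let n0 : 0 < N%:R :> R. Proof. by rewrite ltr0n; lia. Qed.

Let gap : R := 1 - @cosZ R N 1.

Lemma sum_inv_quadratic (al : R) (n : nat) : 0 < al ->
  \sum_(1 <= i < n.+1) (1 + al ^+ 2 * i%:R ^+ 2)^-1 <= 2 / al.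
Proof.
move=> al0.
(* A telescoping majorant, so that the induction closes and the bound does not depend on [n]. *)
have h : \sum_(1 <= i < n.+1) (1 + al ^+ 2 * i%:R ^+ 2)^-1 <=
    2 / al * (1 - (1 + al * n%:R)^-1).
  elim: n => [|n IH]; first by rewrite big_geq // mulr0 addr0 invr1 subrr mulr0.
  rewrite big_nat_recr //=; apply: le_trans (lerD IH (lexx _)) _.
  set v : R := n%:R; have v0 : 0 <= v by [].
  have av : 0 <= al * v by rewrite mulr_ge0 // ltW.
  rewrite -[n.+1%:R]natr1 -/v.
  have -> : 2 / al * (1 - (1 + al * (v + 1))^-1) =
      2 / al * (1 - (1 + al * v)^-1) + 2 / ((1 + al * v) * (1 + al * (v + 1))).
    field; apply/and3P; split; lra.
  (* [(1 + y)(1 + y')] is at most [(1 + y')^2 <= 2 (1 + y'^2)] for [y <= y']. *)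
  have p1 : 0 < 1 + al * v by lra.
  have p2 : 0 < 1 + al * (v + 1) by nra.
  rewrite lerD2l -[X in X <= _]div1r ler_pdivlMr ?mulr_gt0 // mulrAC ler_pdivrMr ?mul1r.
    rewrite -exprMn; apply: (@le_trans _ _ ((1 + al * (v + 1)) ^+ 2)).
      by rewrite expr2 ler_pM2r //; lra.
    by have := sqr_ge0 (1 - al * (v + 1)); lra.
  by rewrite ltr_pwDl // mulr_ge0 // exprn_ge0 // ?ltW //; lra.
apply: (le_trans h); rewrite ler_piMr ?divr_ge0 ?(ltW al0) //.
by rewrite gerBl invr_ge0 addr_ge0 // mulr_ge0 // ltW.
Qed.

Lemma sum_zabs (f : nat -> R) : (forall n, 0 <= f n) ->
  \sum_(a : 'Z_N | a != 0) f (zabs a) <= 2 * \sum_(1 <= i < N.+1) f i.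
Proof.
move=> f0.
apply: (@le_trans _ _ (\sum_(a : 'Z_N | a != 0) (f a + f (N - a)%N))).
  apply: ler_sum => a _; rewrite /zabs; case: (leqP a (N - a)) => _.
    by rewrite lerDl.
  by rewrite lerDr.
have sumE (G : nat -> R) :
    \sum_(a : 'Z_N | a != 0) G a = \sum_(1 <= i < N) G i.
  transitivity (\sum_(a : 'Z_N) (if (a : nat) == 0%N then 0 else G a)).
    rewrite big_mkcond; apply: eq_bigr => a _.
    by rewrite -[a == 0]/((a : nat) == 0%N); case: eqP.
  rewrite -(big_mkord xpredT (fun i => if i == 0%N then 0 else G i)) Zp_cast //.
  rewrite big_ltn ?(ltnW N1) // add0r !big_nat; apply: eq_bigr => i /andP[i0 _].
  by rewrite gtn_eqF.
rewrite big_split /= mulrDl mul1r sumE (sumE (fun i => f (N - i)%N)).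
rewrite [X in _ + X]big_nat_rev /=; apply: lerD.
  by rewrite big_nat_recr ?(ltnW N1) //= lerDl.
rewrite [leRHS]big_nat_recr ?(ltnW N1) //= ler_wpDr //.
by rewrite !big_nat; apply: ler_sum => i /andP[i1 iN]; rewrite (_ : _ - _ = i)%N //; lia.
Qed.

Lemma sum_zabs_inv_quadratic (al : R) : 0 < al ->
  \sum_(a : 'Z_N | a != 0) (1 + al ^+ 2 * (zabs a)%:R ^+ 2)^-1 <= 4 / al.
Proof.
move=> al0; apply: le_trans (sum_zabs (f := fun n => (1 + al ^+ 2 * n%:R ^+ 2)^-1) _) _.
  by move=> n; rewrite invr_ge0 addr_ge0 // mulr_ge0 ?sqr_ge0.
rewrite (_ : 4 / al = 2 * (2 / al)); last by rewrite mulrA; congr (_ / _); lra.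
by rewrite ler_pM2l // sum_inv_quadratic.
Qed.

Lemma expRN_le (y : R) : 0 <= y -> expR (- y) <= (1 + y)^-1.
Proof.
move=> y0; rewrite expRN lef_pV2 ?posrE ?expR_gt0 ?expR_ge1Dx //; lra.
Qed.

(** The return probability at time [u] of the walk on the cycle. *)
Definition circle_heat (u : R) : R :=
  N%:R^-1 * \sum_(a : 'Z_N) expR (- (1 - @cosZ R N a) * u).

(** The square root is the modulus of the character at a unit step minus 1; the sum dominates every
    discrete gradient of the heat kernel on the cycle. *)
Definition circle_gradient (u : R) : R :=
  N%:R^-1 * \sum_(a : 'Z_N) expR (- (1 - @cosZ R N a) * u) *
    Num.sqrt (2 * (1 - @cosZ R N a)).

Let mn (u : R) := Num.min (N%:R ^+ 2) u.

Let mn_gt0 (u : R) : 0 < u -> 0 < mn u.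
Proof. by move=> u0; rewrite lt_min u0 exprn_gt0. Qed.

Let symbol_ge a : (zabs a)%:R ^+ 2 / (2 * N%:R ^+ 2) <= 1 - @cosZ R N a.
Proof. exact: one_sub_cosZ_ge. Qed.

(** The zero mode contributes 1/N and the others at most 8 / sqrt u, hence 9^2 after squaring. The
    squared form keeps the exponents of min(N^2, u) integral. *)
Lemma circle_heat_sqr_le (u : R) : 0 < u -> circle_heat u ^+ 2 <= 81 / mn u.
Proof.
move=> u0; set q := Num.sqrt u; have q0 : 0 < q by rewrite sqrtr_gt0.
have q2 : q ^+ 2 = u by rewrite sqr_sqrtr // ltW.
set w := Num.sqrt (mn u); have w0 : 0 < w by rewrite sqrtr_gt0 mn_gt0.
have w2 : w ^+ 2 = mn u by rewrite sqr_sqrtr // ltW // mn_gt0.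
have wq : w <= q by rewrite ler_wsqrtr // ge_min lexx orbT.
have wN : w <= N%:R.
  by rewrite -[leRHS]ger0_norm // -sqrtr_sqr ler_wsqrtr // ge_min lexx.
have h : circle_heat u <= 9 / w.
  apply: (@le_trans _ _ (N%:R^-1 + 8 / q)).
    rewrite /circle_heat mulrC ler_pdivrMr // mulrDl mulVf ?gt_eqF //.
    rewrite (bigD1 0) //= cosZ0 subrr oppr0 mul0r expR0 lerD2l.
    (* With this slope the quadratic term is half of the lower bound on the exponent. *)
    have al0 : 0 < q / (2 * N%:R) by rewrite divr_gt0 // mulr_gt0.
    apply: le_trans (_ : _ <= 4 / (q / (2 * N%:R))) _; last first.
      by rewrite le_eqVlt; apply/orP; left; apply/eqP; field; rewrite !gt_eqF.
    apply: le_trans (sum_zabs_inv_quadratic al0).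
    apply: ler_sum => a _; rewrite mulNr.
    have z0 : 0 <= (zabs a)%:R ^+ 2 / (2 * N%:R ^+ 2) :> R.
      by rewrite divr_ge0 ?mulr_ge0 ?sqr_ge0.
    have y0 := le_trans z0 (symbol_ge a).
    apply: le_trans (expRN_le _) _; first by rewrite mulr_ge0 // ltW.
    rewrite lef_pV2 ?posrE.
    - rewrite lerD2l (_ : _ * _ = (zabs a)%:R ^+ 2 / (2 * N%:R ^+ 2) / 2 * u); last first.
        by rewrite -q2; field; rewrite gt_eqF.
      rewrite ler_pM2r //; apply: le_trans (symbol_ge a); lra.
    - by apply: ltr_pwDl => //; rewrite mulr_ge0 // ltW.
    - by apply: ltr_pwDl => //; rewrite mulr_ge0 ?sqr_ge0.
  rewrite (_ : 9 / w = w^-1 + 8 / w); last by field; rewrite gt_eqF.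
  by rewrite lerD // ?ler_pM2l // lef_pV2.
have h0 : 0 <= circle_heat u.
  by rewrite mulr_ge0 ?invr_ge0 // sumr_ge0 // => a _; exact: expR_ge0.
rewrite (_ : 81 / mn u = (9 / w) ^+ 2); first by rewrite lerXn2r // nnegrE ?divr_ge0 // ltW.
by rewrite -w2; field; rewrite gt_eqF.
Qed.

(** The exponential must come out with the exact rate [gap]. The modes 1 and -1 have this rate. Any
    other nonzero mode has rate mu at least 2 gap, so half of its exponent pays for the exponential
    and the other half splits into two equal parts: one absorbs the square root at the cost of 1 /
    sqrt u, the other makes the sum over modes converge. *)
Lemma circle_gradient_le (u : R) : 0 < u ->
  circle_gradient u <= 34 / mn u * expR (- gap * u).
Proof.
move=> u0; set q := Num.sqrt u; have q0 : 0 < q by rewrite sqrtr_gt0.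
have q2 : q ^+ 2 = u by rewrite sqr_sqrtr // ltW.
set al := q / (3 * N%:R); have al0 : 0 < al by rewrite divr_gt0 // mulr_gt0.
pose f a : R := (1 + al ^+ 2 * (zabs a)%:R ^+ 2)^-1.
have gap0 : 0 <= gap by rewrite subr_ge0 cosZ_le1.
have gapE a : zabs a = 1%N -> 1 - @cosZ R N a = gap.
  move=> /eqP; rewrite zabs_eq1 // => /orP[] /eqP -> //.
  by rewrite cosZN.
have gap_le : Num.sqrt (2 * gap) <= 8 / N%:R.
  rewrite -[leRHS]ger0_norm ?divr_ge0 // -sqrtr_sqr ler_wsqrtr //.
  have := @one_sub_cosZ_le R N N1 1; rewrite zabs1 // expr1n mulr1 -/gap => h.
  apply: (@le_trans _ _ (2 * (32 / N%:R ^+ 2))); first by rewrite ler_pM2l.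
  by rewrite le_eqVlt; apply/orP; left; apply/eqP; field; rewrite gt_eqF.
have term a : a != 0 -> expR (- (1 - @cosZ R N a) * u) *
    Num.sqrt (2 * (1 - @cosZ R N a)) <=
    expR (- gap * u) * (8 / N%:R * ((a == 1)%:R + (a == -1)%:R) + 3 / 2 / q * f a).
  move=> a0; have f0 : 0 < f a.
    by rewrite invr_gt0; apply: ltr_pwDl => //; rewrite mulr_ge0 ?sqr_ge0.
  have qf0 : 0 <= 3 / 2 / q * f a.
    by apply: mulr_ge0; [rewrite divr_ge0 // ltW | exact: ltW].
  have z0 : (0 < zabs a)%N by rewrite lt0n zabs_eq0.
  have [z1|z1] := leqP (zabs a) 1.
    have {}z1 : zabs a = 1%N by lia.
    rewrite gapE // ler_pM2l ?expR_gt0 //; apply: (le_trans gap_le).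
    have : 1 <= (a == 1)%:R + (a == -1)%:R :> R.
      move/eqP: z1; rewrite zabs_eq1 // => /orP[] ->; [rewrite lerDl | rewrite lerDr].
        by case: (_ == _).
      by case: (_ == _).
    move=> h; rewrite -[X in X <= _]addr0 lerD //.
    by rewrite ler_peMr // divr_ge0.
  have := @one_sub_cosZ_ge2 R N N1 a N4 z1; rewrite -/gap; set mu := 1 - _ => gmu.
  have mu0 : 0 <= mu by rewrite subr_ge0 cosZ_le1.
  apply: (@le_trans _ _ (expR (- gap * u) * (expR (- (mu * u / 2)) * Num.sqrt (2 * mu)))).
    rewrite mulrA ler_wpM2r ?sqrtr_ge0 // -expRD ler_expR.
    by have : gap * u <= mu / 2 * u; [rewrite ler_pM2r //; lra | lra].
  rewrite ler_pM2l ?expR_gt0 // ler_wpDl //.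
  set y := mu * u / 4; have y0 : 0 <= y by rewrite divr_ge0 // mulr_ge0 // ltW.
  have -> : mu * u / 2 = y + y by rewrite /y; lra.
  rewrite opprD expRD -mulrA mulrC.
  have fy : expR (- y) <= f a.
    apply: le_trans (expRN_le y0) _; rewrite lef_pV2 ?posrE.
    - rewrite lerD2l (_ : _ * _ =
        (zabs a)%:R ^+ 2 / (2 * N%:R ^+ 2) * (2 / 9) * u); last first.
        by rewrite /al -q2; field; rewrite gt_eqF.
      rewrite /y [leRHS]mulrAC ler_pM2r //.
      have z2 : 0 <= (zabs a)%:R ^+ 2 / (2 * N%:R ^+ 2) :> R.
        by rewrite divr_ge0 ?mulr_ge0 ?sqr_ge0.
      by have := symbol_ge a; rewrite -/mu; lra.
    - lra.
    - by apply: ltr_pwDl => //; rewrite mulr_ge0 ?sqr_ge0.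
  apply: ler_pM => //; rewrite ?mulr_ge0 ?expR_ge0 ?sqrtr_ge0 //.
  set r := Num.sqrt (2 * mu).
  have r2 : r ^+ 2 = 2 * mu by rewrite sqr_sqrtr // mulr_ge0.
  have r0 : 0 <= r by rewrite sqrtr_ge0.
  apply: le_trans (ler_wpM2r r0 (expRN_le y0)) _.
  rewrite mulrC ler_pdivrMr; last lra.
  rewrite mulrAC ler_pdivlMr //.
  have -> : y = (r * q) ^+ 2 / 8 by rewrite exprMn r2 q2 /y; lra.
  by have := sqr_ge0 (r * q - 3); have := sqr_ge0 (r * q); nra.
rewrite /circle_gradient.
(* The final 34 is 16 + 18: the two slow modes give 16 / N, the rest 18 N / u, before division by
   N. *)
have S0 : \sum_(a : 'Z_N) expR (- (1 - @cosZ R N a) * u) *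
    Num.sqrt (2 * (1 - @cosZ R N a)) <=
    expR (- gap * u) * (16 / N%:R + 18 * N%:R / u).
  rewrite (bigD1 0) //= cosZ0 subrr mulr0 sqrtr0 mulr0 add0r.
  apply: le_trans (_ : _ <= \sum_(a : 'Z_N | a != 0) expR (- gap * u) *
    (8 / N%:R * ((a == 1)%:R + (a == -1)%:R) + 3 / 2 / q * f a)) _.
    by apply: ler_sum => a a0; exact: term.
  rewrite -mulr_sumr ler_pM2l ?expR_gt0 // big_split /= -!mulr_sumr lerD //.
    rewrite (_ : 16 / N%:R = 8 / N%:R * 2); last by field; rewrite gt_eqF.
    rewrite ler_wpM2l ?divr_ge0 // big_split /=.
    have one (b : 'Z_N) : \sum_(a : 'Z_N | a != 0) (a == b)%:R <= 1 :> R.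
      rewrite big_mkcond /= (bigD1 b) //= big1 => [|a /negPf ->]; last by rewrite if_same.
      by rewrite eqxx addr0; case: ifP.
    by have := one 1; have := one (-1); lra.
  apply: le_trans (ler_wpM2l _ (sum_zabs_inv_quadratic al0)) _.
    by rewrite divr_ge0 // ltW.
  by rewrite le_eqVlt; apply/orP; left; apply/eqP; rewrite /al -q2; field; rewrite !gt_eqF.
rewrite mulrC ler_pdivrMr //; apply: (le_trans S0).
rewrite [leRHS]mulrAC [leRHS]mulrC ler_pM2l ?expR_gt0 //.
have m0 := mn_gt0 u0.
have mN : mn u <= N%:R ^+ 2 by rewrite ge_min lexx.
have mu : mn u <= u by rewrite ge_min lexx orbT.
rewrite (_ : 34 / mn u * N%:R = 16 * N%:R / mn u + 18 * N%:R / mn u); last first.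
  by field; rewrite gt_eqF.
apply: lerD.
  rewrite (_ : 16 / N%:R = 16 * N%:R / N%:R ^+ 2); last by field; rewrite gt_eqF.
  by rewrite ler_pM2l ?mulr_gt0 // lef_pV2 // posrE exprn_gt0.
by rewrite ler_pM2l ?mulr_gt0 // lef_pV2.
Qed.

End circle_sums.

Section heat_kernel.
Variables (R : realType) (d N : nat).
Hypothesis N4 : (3 < N)%N.
Implicit Types x y z k : torus d N.
Let N1 : (1 < N)%N. Proof. exact: leq_trans N4. Qed.
Let Nd0 : 0 < (N ^ d)%:R :> R. Proof. by rewrite ltr0n expn_gt0 (ltnW N1). Qed.
Let gap : R := 1 - cosZ (1 : 'Z_N).

(** The heat kernel, defined by its Fourier expansion: the heat equation and the gradient bound can
    both be read off term by term. *)
Definition heat (t : R) x z : R :=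
  (N ^ d)%:R^-1 * \sum_k expR (- symbol R k * t) * cosZ (phase k z - phase k x).

Lemma heat0 x z : heat 0 x z = (z == x)%:R.
Proof.
rewrite /heat; under eq_bigr do rewrite mulr0 expR0 mul1r.
by rewrite wave_orthogonal // mulKf // gt_eqF.
Qed.

Lemma torus_laplacian_lin (I : finType) (c : R) (a : I -> R)
    (f : I -> torus d N -> R) z :
  torus_laplacian (fun z => c * \sum_i a i * f i z) z =
  c * \sum_i a i * torus_laplacian (f i) z.
Proof.
rewrite /torus_laplacian.
under [in RHS]eq_bigr do rewrite mulrCA mulr_sumr.
rewrite -[in RHS]mulr_sumr [RHS]mulrCA exchange_big; congr (_ * _).
rewrite [RHS]mulr_sumr; apply: eq_bigr => w _.
by rewrite -mulrBr -sumrB; congr (_ * _); apply: eq_bigr => i _; rewrite mulrBr.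
Qed.

Lemma torus_laplacian_cosZ k x z :
  torus_laplacian (fun z => cosZ (phase k z - phase k x)) z =
  - symbol R k * cosZ (phase k z - phase k x).
Proof.
have e w : cosZ (phase k w - phase k x) =
    1 * \sum_b wave R b k x * wave R b k w.
  by rewrite -sum_wave // mul1r; apply: eq_bigr => b _; rewrite mulrC.
rewrite (_ : (fun w => _) = fun w => 1 * \sum_b wave R b k x * wave R b k w); last first.
  by apply/funext => w; exact: e.
rewrite torus_laplacian_lin e mul1r mul1r mulr_sumr; apply: eq_bigr => b _.
by rewrite torus_laplacian_wave // mulrCA.
Qed.

(** The finite Fourier sum also makes sense at negative times, so [s] need not stay below [t]. *)
Lemma heat_backward_derivable (t : R) x z :
  forward_derivable (fun s => heat (t - s) x z)
    (fun s => - torus_laplacian (heat (t - s) x) z).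
Proof.
have h : forward_derivable
    (fun s => (N ^ d)%:R^-1 * \sum_k
      expR (symbol R k * (s - t)) * cosZ (phase k z - phase k x))
    (fun s => (N ^ d)%:R^-1 * \sum_k
      (symbol R k * expR (symbol R k * (s - t)) * cosZ (phase k z - phase k x) +
       expR (symbol R k * (s - t)) * 0)).
  apply: forward_derivableZ; apply: forward_derivable_sum => k _.
  apply: forward_derivableM; first exact: forward_derivable_expR.
  exact: forward_derivable_cst.
rewrite (_ : (fun s => heat (t - s) x z) =
    fun s => (N ^ d)%:R^-1 * \sum_k
      expR (symbol R k * (s - t)) * cosZ (phase k z - phase k x)).
  apply: (forward_derivable_ext h) => s _.
  rewrite torus_laplacian_lin -mulrN -sumrN; congr (_ * _); apply: eq_bigr => k _.
  rewrite torus_laplacian_cosZ mulr0 addr0 !mulNr mulrN opprK -mulrN opprB.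
  by rewrite mulrCA mulrA.
apply/funext => s; rewrite /heat; congr (_ * _); apply: eq_bigr => k _.
by rewrite mulNr -mulrN opprB.
Qed.

Lemma unit_pairing_sqr_le (p q r s : R) : p ^+ 2 + q ^+ 2 = 1 ->
  (p * r + q * s) ^+ 2 <= r ^+ 2 + s ^+ 2.
Proof.
move=> e; rewrite -subr_ge0.
rewrite (_ : _ - _ = (1 - (p ^+ 2 + q ^+ 2)) * (r ^+ 2 + s ^+ 2) +
  (p * s - q * r) ^+ 2); last by ring.
by rewrite e subrr mul0r add0r sqr_ge0.
Qed.

(** Neighbours differ in one coordinate [j], and by Cauchy-Schwarz the difference of the two cosines
    is bounded by a quantity depending on [k j] only. The sum over frequencies then factors into one
    [circle_gradient] and d - 1 copies of [circle_heat]; after squaring these contribute 2 and d - 1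
    to the exponent d + 1. *)
Lemma heat_gradient_sqr_le (u : R) x y z : 0 < u -> torus_dist x y == 1%N ->
  (heat u x z - heat u y z) ^+ 2 <=
  34 ^+ 2 * 81 ^+ d.-1 / Num.min (N%:R ^+ 2) u ^+ d.+1 * expR (- gap * u) ^+ 2.
Proof.
move=> u0 xy; have [j [a [a1 ->]]] := torus_dist1P R N4 xy.
have m0 : 0 < Num.min (N%:R ^+ 2) u by rewrite lt_min u0 exprn_gt0 // ltr0n ltnW.
set m := Num.min _ _ in m0 *.
have h : `|heat u x z - heat u (step x j a) z| <=
    @circle_gradient R N u * @circle_heat R N u ^+ d.-1.
  rewrite -mulrBr -sumrB normrM gtr0_norm ?invr_gt0 //.
  pose F (i : 'I_d) (b : 'Z_N) : R := expR (- (1 - cosZ b) * u) *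
    (if i == j then Num.sqrt (2 * (1 - cosZ b)) else 1).
  have -> : @circle_gradient R N u * @circle_heat R N u ^+ d.-1 =
      (N ^ d)%:R^-1 * \sum_(k : torus d N) \prod_(i < d) F i (k i).
    have <- : \prod_(i < d) \sum_(b : 'Z_N) F i b =
        \sum_(k : torus d N) \prod_(i < d) F i (k i).
      exact: bigA_distr_bigA.
    have -> : (N ^ d)%:R^-1 = \prod_(i < d) N%:R^-1 :> R.
      by rewrite prodr_const card_ord natrX exprVn.
    rewrite -big_split /= (bigD1 j) //=; congr (_ * _).
      by congr (_ * _); apply: eq_bigr => b _; rewrite /F eqxx.
    transitivity (\prod_(i < d | i != j) @circle_heat R N u : R).
      rewrite prodr_const; congr (_ ^+ _).
      by rewrite -[in LHS](card_ord d) -(cardC1 j); apply: eq_card => i.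
    apply: eq_bigr => i /negPf ij; congr (_ * _); apply: eq_bigr => b _.
    by rewrite /F ij mulr1.
  rewrite ler_pM2l ?invr_gt0 //; apply: le_trans (ler_norm_sum _ _ _) _.
  apply: ler_sum => k _; rewrite -mulrBr normrM gtr0_norm ?expR_gt0 //.
  rewrite /F big_split /=.
  have -> : \prod_i expR (- (1 - cosZ (k i)) * u) = expR (- symbol R k * u).
    rewrite -expR_sum; congr expR.
    by rewrite /symbol mulNr mulr_suml -sumrN; apply: eq_bigr => i _; rewrite mulNr.
  rewrite ler_pM2l ?expR_gt0 // -big_mkcond /= big_pred1_eq.
  rewrite -sqrtr_sqr ler_wsqrtr //.
  have -> : 1 - cosZ (k j) = 1 - cosZ (phase k x - phase k (step x j a)) :> R.
    rewrite phase_step_sub //; case: a1 => ->; first by rewrite mulr1.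
    by rewrite mulrN1 cosZN.
  have := sum_wave_gradient R N4 k x (step x j a) => <-.
  have e w : cosZ (phase k z - phase k w) = \sum_b wave R b k z * wave R b k w.
    by rewrite sum_wave.
  have s1 : \sum_b wave R b k z ^+ 2 = 1 by exact: sum_wave_sqr.
  move: s1; rewrite !e !big_bool.
  set p := wave R true k z; set q := wave R false k z.
  set p' := wave R true k x; set q' := wave R false k x.
  set p'' := wave R true k _; set q'' := wave R false k _ => s1.
  rewrite /= in s1 *.
  rewrite (_ : p * p' + _ - _ = p * (p' - p'') + q * (q' - q'')); last by ring.
  exact: unit_pairing_sqr_le.
have cg0 : 0 <= @circle_gradient R N u :> R.
  apply: mulr_ge0; first by rewrite invr_ge0.
  by apply: sumr_ge0 => b _; apply: mulr_ge0; rewrite ?expR_ge0 ?sqrtr_ge0.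
have ch0 : 0 <= @circle_heat R N u :> R.
  apply: mulr_ge0; first by rewrite invr_ge0.
  by apply: sumr_ge0 => b _; exact: expR_ge0.
rewrite -[X in X <= _]real_normK ?num_real //.
apply: (@le_trans _ _ ((@circle_gradient R N u * @circle_heat R N u ^+ d.-1) ^+ 2)).
  by rewrite lerXn2r // nnegrE ?normr_ge0 // mulr_ge0 // exprn_ge0.
rewrite exprMn -exprM mulnC exprM.
have -> : 34 ^+ 2 * 81 ^+ d.-1 / m ^+ d.+1 * expR (- gap * u) ^+ 2 =
    (34 / m * expR (- gap * u)) ^+ 2 * (81 / m) ^+ d.-1.
  have -> : m ^+ d.+1 = m ^+ 2 * m ^+ d.-1.
    by rewrite -exprD; congr (_ ^+ _); have := ltn_ord j; lia.
  rewrite !exprMn !exprVn invfM; ring.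
apply: ler_pM; rewrite ?exprn_ge0 //.
- rewrite lerXn2r // ?nnegrE ?mulr_ge0 ?expR_ge0 ?invr_ge0 ?(ltW m0) //.
  exact: circle_gradient_le.
- rewrite lerXn2r // ?nnegrE ?divr_ge0 ?exprn_ge0 ?(ltW m0) //.
  exact: circle_heat_sqr_le.
Qed.

End heat_kernel.

(** * The Lyapunov function *)

Section unit_mass_moments.
Variables (R : realType) (d N : nat).
Hypothesis N4 : (3 < N)%N.
Let N1 : (1 < N)%N. Proof. exact: leq_trans N4. Qed.
Let E := @prob_configs R d N.
Variable S : R -> (config R d N -> R) -> config R d N -> R.
Hypothesis semiS : markov_semigroup E S.
Hypothesis genS : has_generator E S (@averaging_generator R d N).
Implicit Types (x y z k : torus d N) (s t : R).

Let eta0 : config R d N := unit_mass R (origin d N).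

Lemma unit_mass_prob : E eta0.
Proof.
split=> [x|]; first exact: ler0n.
rewrite (bigD1 (origin d N)) //= big1 => [|x /negPf xo].
  by rewrite /eta0 /unit_mass eqxx addr0.
by rewrite /eta0 /unit_mass xo.
Qed.

Local Notation m2 := (second_moment S eta0).
Local Notation pm := (pairing_moment S eta0).
Local Notation gm := (gradient_moment S eta0).

Lemma sum_indicator_sub (F : torus d N -> R) x y :
  \sum_z ((z == x)%:R - (z == y)%:R) * F z = F x - F y.
Proof.
have pick w : \sum_z (z == w)%:R * F z = F w.
  rewrite (bigD1 w) //= eqxx mul1r big1 ?addr0 // => z /negPf ->.
  by rewrite mul0r.
by under eq_bigr do rewrite mulrBl; rewrite sumrB !pick.
Qed.

Lemma gradient_moment_ge0 s x y : 0 <= s -> 0 <= gm s x y.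
Proof.
move=> s0; apply: (semigroup_positive semiS) => //.
- exact: gradient_continuous.
- by move=> eta _; exact: sqr_ge0.
- exact/mem_set/unit_mass_prob.
Qed.

(** This crude bound serves the times up to 1 and makes the supremum of the bootstrap finite. *)
Lemma gradient_moment_le1 s x y : 0 <= s -> gm s x y <= 1.
Proof.
move=> s0; have E0 := mem_set unit_mass_prob.
rewrite -[leRHS](semigroup_cst semiS 1 s0 E0).
apply: (semigroup_le semiS) => //; first exact: gradient_continuous.
  by move=> ?; exact: cvg_cst.
move=> eta [eta_ge0 eta1].
have le1 z : 0 <= eta z <= 1.
  rewrite eta_ge0 /= -eta1 (bigD1 z) //= lerDl; apply: sumr_ge0 => w _.
  exact: eta_ge0.
by have := le1 x; have := le1 y; nra.
Qed.

Lemma pairing_moment_ge0 s (g : torus d N -> R) : 0 <= s -> 0 <= pm s g.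
Proof.
move=> s0; have [c <-] := pairing_momentE semiS unit_mass_prob g s0.
apply: (semigroup_positive semiS) => //; last exact/mem_set/unit_mass_prob.
by move=> eta _; exact: sqr_ge0.
Qed.

Lemma pairing_moment0 (g : torus d N -> R) : pm 0 g = g (origin d N) ^+ 2.
Proof.
have [c <-] := pairing_momentE semiS unit_mass_prob g (lexx 0).
rewrite (semigroup0 semiS c) ?inE; last exact: unit_mass_prob.
congr (_ ^+ 2); rewrite /pairing (bigD1 (origin d N)) //= big1 => [|z /negPf zo].
  by rewrite /eta0 /unit_mass eqxx mulr1 addr0.
by rewrite /eta0 /unit_mass zo mulr0.
Qed.

Lemma gradient_momentE s x y : 0 <= s ->
  gm s x y = pm s (fun z => (z == x)%:R - (z == y)%:R).
Proof.
move=> s0; have [c <-] := pairing_momentE semiS unit_mass_prob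
  (fun z => (z == x)%:R - (z == y)%:R) s0.
by congr (S s _ eta0); apply/funext => eta; rewrite /pairing sum_indicator_sub.
Qed.

Lemma gradient_moment_second s x y : 0 <= s ->
  gm s x y = m2 s x x - 2 * m2 s x y + m2 s y y.
Proof.
move=> s0; rewrite gradient_momentE // /pairing_moment.
under eq_bigr do under eq_bigr do rewrite -mulrA.
under eq_bigr do rewrite -mulr_sumr sum_indicator_sub.
by rewrite sum_indicator_sub [X in _ - (X - _)]second_momentC; lra.
Qed.

Lemma pairing_momentZ s (c : R) (g : torus d N -> R) :
  pm s (fun z => c * g z) = c ^+ 2 * pm s g.
Proof.
rewrite /pairing_moment mulr_sumr; apply: eq_bigr => z _.
by rewrite mulr_sumr; apply: eq_bigr => w _; ring.
Qed.

(** [heat 0 z] is the unit mass at [z] in Fourier form. Multiplying by the symbol applies minus the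
    Laplacian to it, and summation by parts then gives differences of second moments. *)
Lemma pairing_moment_parseval s : 0 <= s ->
  (N ^ d)%:R^-1 * \sum_k symbol R k * \sum_b pm s (wave R b k) =
  4^-1 * \sum_(x : torus d N) \sum_(y : torus d N | torus_dist x y == 1%N) gm s x y.
Proof.
move=> s0.
have -> : \sum_(x : torus d N) \sum_(y : torus d N | torus_dist x y == 1%N) gm s x y =
    2 * \sum_(x : torus d N) \sum_(y : torus d N | torus_dist x y == 1%N)
      (m2 s x x - m2 s x y).
  under eq_bigr do under eq_bigr do rewrite gradient_moment_second //.
  under eq_bigr do rewrite big_split /=.
  rewrite big_split /= [X in _ + X](exchange_neighbours N1) -big_split mulr_sumr.
  apply: eq_bigr => x _; rewrite -big_split mulr_sumr; apply: eq_bigr => y _ /=; lra.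
have wE k : \sum_b pm s (wave R b k) =
    \sum_z \sum_w cosZ (phase k w - phase k z) * m2 s z w.
  rewrite /pairing_moment exchange_big; apply: eq_bigr => z _ /=.
  rewrite exchange_big; apply: eq_bigr => w _ /=.
  rewrite -mulr_suml -(sum_wave R N4); congr (_ * _).
  by apply: eq_bigr => b _; rewrite mulrC.
under eq_bigr do rewrite wE mulr_sumr.
rewrite exchange_big mulr_sumr [RHS]mulrA mulr_sumr; apply: eq_bigr => z _ /=.
under eq_bigr do rewrite mulr_sumr.
rewrite exchange_big mulr_sumr /=.
transitivity (\sum_w - torus_laplacian (heat 0 z) w * m2 s z w).
  apply: eq_bigr => w _; rewrite (torus_laplacian_lin _ (fun k => expR (- symbol R k * 0))).
  rewrite -mulrN -sumrN -mulrA mulr_suml; congr (_ * _); apply: eq_bigr => k _.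
  by rewrite torus_laplacian_cosZ // mulr0 expR0 mul1r !mulNr opprK mulrA.
transitivity (- pairing (m2 s z) (torus_laplacian (heat 0 z))).
  by rewrite -sumrN; apply: eq_bigr => w _; rewrite mulNr.
have := sum_gradients N1 (heat 0 z) (m2 s z) => e.
have -> : - pairing (m2 s z) (torus_laplacian (heat 0 z)) =
  4^-1 * \sum_(x : torus d N) \sum_(y : torus d N | torus_dist x y == 1%N)
    (m2 s z x - m2 s z y) * (heat 0 z x - heat 0 z y) by rewrite e; lra.
have -> : \sum_(x : torus d N) \sum_(y : torus d N | torus_dist x y == 1%N)
    (m2 s z x - m2 s z y) * (heat 0 z x - heat 0 z y) =
  2 * \sum_(x : torus d N) \sum_(y : torus d N | torus_dist x y == 1%N)
    (m2 s z x - m2 s z y) * heat 0 z x.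
  under eq_bigr do under eq_bigr do rewrite mulrBr.
  under eq_bigr do rewrite sumrB.
  rewrite sumrB [X in _ - X](exchange_neighbours N1) mulr_sumr -sumrB.
  apply: eq_bigr => x _; rewrite -sumrB mulr_sumr; apply: eq_bigr => y _; lra.
rewrite mulrA; congr (_ * _).
rewrite (bigD1 z) //= [X in _ + X]big1 ?addr0.
  by apply: eq_bigr => y _; rewrite heat0 // eqxx mulr1.
move=> x /negPf xz; apply: big1 => y _.
by rewrite heat0 // xz mulr0.
Qed.

End unit_mass_moments.

Section lyapunov.
Variables (R : realType) (d N : nat).
Hypothesis N4 : (3 < N)%N.
Let N1 : (1 < N)%N. Proof. exact: leq_trans N4. Qed.
Implicit Types (x y z k : torus d N) (s t : R).
Local Notation gap := (1 - @cosZ R N 1).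

Lemma torus_laplacianZ (c : R) (g : torus d N -> R) z :
  torus_laplacian (fun z => c * g z) z = c * torus_laplacian g z.
Proof.
rewrite /torus_laplacian [RHS]mulrCA; congr (_ * _); rewrite mulr_sumr.
by apply: eq_bigr => w _; rewrite mulrBr.
Qed.

(* Positive exactly on the [2 d] frequencies with [symbol k = gap]. *)
Definition slow_count k : nat :=
  \sum_(j < d) ((k == step (origin d N) j 1%R) + (k == step (origin d N) j (-1)%R))%N.

Lemma sum_slow_count : \sum_k (slow_count k)%:R = (2 * d)%:R :> R.
Proof.
rewrite -natr_sum exchange_big /=; congr (_%:R).
under eq_bigr do rewrite big_split /=.
have pick z : (\sum_k (k == z) = 1)%N.
  by rewrite (bigD1 z) //= eqxx big1 // => k /negPf ->.
by under eq_bigr do rewrite !pick; rewrite sum_nat_const card_ord; lia.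
Qed.

Lemma gap_gt0 : 0 < gap.
Proof.
apply: lt_le_trans (@one_sub_cosZ_ge R N N1 1).
by rewrite zabs1 // expr1n div1r invr_gt0 mulr_gt0 // exprn_gt0 // ltr0n; lia.
Qed.

Lemma symbol_summand_ge0 k j : 0 <= 1 - cosZ (k j) :> R.
Proof. by rewrite subr_ge0 cosZ_le1. Qed.

Lemma one_sub_cosZ_le_symbol k j : 1 - cosZ (k j) <= symbol R k.
Proof.
by rewrite /symbol (bigD1 j) //= lerDl; apply: sumr_ge0 => i _; exact: symbol_summand_ge0.
Qed.

Lemma one_sub_cosZ_ge_gap (a : 'Z_N) : a != 0 -> gap <= 1 - cosZ a.
Proof.
rewrite -zabs_eq0 // -lt0n => a0.
have [a1|a1] := leqP (zabs a) 1.
  have /eqP : zabs a = 1%N by lia.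
  by rewrite zabs_eq1 // => /orP[] /eqP ->; rewrite ?cosZN.
apply: le_trans (@one_sub_cosZ_ge2 R N N1 a N4 a1).
by rewrite ler_peMl ?ler1n // ltW // gap_gt0.
Qed.

(** Two nonzero coordinates already cost 2 gap, and so does one coordinate at distance at least 2
    from 0. Since [beta] lies just below 2 gap, [2 * symbol - beta] is [- beta] in the first case,
    [delta] in the second and larger than 2 gap in the third. *)
Lemma symbol_cases k :
  [\/ k = origin d N /\ symbol R k = 0,
      symbol R k = gap /\ (0 < slow_count k)%N |
      2 * gap <= symbol R k].
Proof.
have [/existsP[j kj]|] := boolP [exists j, k j != 0]; last first.
  rewrite negb_exists => /forallP k0.
  have -> : k = origin d N.
    by apply/ffunP => j; rewrite ffunE; apply/eqP; rewrite -[_ == _]negbK.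
  apply: Or31; split=> //.
  by rewrite /symbol big1 // => j _; rewrite ffunE cosZ0 subrr.
have [/existsP[i /andP[ij ki]]|] := boolP [exists i, (i != j) && (k i != 0)].
  apply: Or33; rewrite /symbol (bigD1 j) //= (bigD1 i) //=.
  have T0 : 0 <= \sum_(l < d | (l != j) && (l != i)) (1 - cosZ (k l)) :> R.
    by apply: sumr_ge0 => l _; exact: symbol_summand_ge0.
  by have := one_sub_cosZ_ge_gap kj; have := one_sub_cosZ_ge_gap ki; lra.
rewrite negb_exists => /forallP k0.
have kE : k = step (origin d N) j (k j).
  apply/ffunP => i; rewrite !ffunE add0r; case: eqP => [-> //|/eqP ij].
  by move: (k0 i); rewrite ij /= negbK => /eqP.
have [z1|z1] := leqP (zabs (k j)) 1; last first.
  apply: Or33; apply: le_trans (one_sub_cosZ_le_symbol k j).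
  exact: one_sub_cosZ_ge2.
have z0 : (0 < zabs (k j))%N by rewrite lt0n zabs_eq0.
have /eqP : zabs (k j) = 1%N by lia.
rewrite zabs_eq1 // => kj1; apply: Or32; split.
  rewrite /symbol (bigD1 j) //= big1 ?addr0.
    by case/orP: kj1 => /eqP ->; rewrite ?cosZN.
  move=> i ij; move: (k0 i); rewrite ij /= negbK => /eqP ->.
  by rewrite cosZ0 subrr.
rewrite /slow_count (bigD1 j) //= addn_gt0; apply/orP; left.
by case/orP: kj1 => /eqP e; rewrite e in kE; rewrite -kE eqxx // addnC.
Qed.

Variables beta delta : R.
Hypothesis beta_gt0 : 0 < beta.
Hypothesis delta_gt0 : 0 < delta.
Hypothesis beta_delta : beta + delta = 2 * gap :> R.

Let rates_gt0 : [/\ 0 < beta, 0 < delta, beta + delta = 2 * gap & 0 < gap].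
Proof. by split=> //; exact: gap_gt0. Qed.

(* Makes [mode_weight k * (beta - 2 symbol k)] proportional to [symbol k], so that
   Parseval turns the decay of the modes into the Dirichlet form; the zero mode
   gets weight 0. *)
Definition mode_weight k : R := 8 * symbol R k / (2 * symbol R k - beta).

Lemma mode_weight_ge0 k : 0 <= mode_weight k.
Proof.
rewrite /mode_weight; have [b0 d0 bd g0] := rates_gt0.
case: (symbol_cases k) => [[_ ->]|[-> _]|h]; first by rewrite mulr0 mul0r.
  by rewrite divr_ge0 //; lra.
by rewrite divr_ge0 //; lra.
Qed.

Lemma mode_weightE k : mode_weight k * (beta - 2 * symbol R k) = - (8 * symbol R k).
Proof.
have n0 : 2 * symbol R k - beta != 0.
  have [b0 d0 bd g0] := rates_gt0; case: (symbol_cases k) => [[_ ->]|[-> _]|h].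
  - by rewrite lt_eqF //; lra.
  - by rewrite gt_eqF //; lra.
  - by rewrite gt_eqF //; lra.
by rewrite /mode_weight; field.
Qed.

(** For a fast mode the symbol is at least [beta], so the denominator is at least the symbol. *)
Lemma mode_weight_le k : mode_weight k <= 8 + 8 * gap / delta * (slow_count k)%:R.
Proof.
have [b0 d0 bd g0] := rates_gt0.
have r0 : 0 <= 8 * gap / delta by rewrite divr_ge0 // ltW //; lra.
have rs0 : 0 <= 8 * gap / delta * (slow_count k)%:R by rewrite mulr_ge0.
rewrite /mode_weight; case: (symbol_cases k) => [[_ ->]|[-> sc]|h].
- by rewrite mulr0 mul0r addr_ge0.
- have -> : 2 * gap - beta = delta by lra.
  have : 8 * gap / delta * 1 <= 8 * gap / delta * (slow_count k)%:R.
    by rewrite ler_wpM2l // ler1n.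
  lra.
- have : 8 * symbol R k / (2 * symbol R k - beta) <= 8 by rewrite ler_pdivrMr; lra.
  lra.
Qed.

(** The weight equals 4 + 4 beta / (2 symbol - beta), and for fast modes 1 - cos is at most the last
    denominator. The leading 4 matters: with the cruder 8 of [mode_weight_le], the gain in
    [dlyapunov_le] would no longer be smaller than the loss. *)
Lemma mode_weight_gradient_le k j :
  mode_weight k * (1 - cosZ (k j)) <=
  4 * (1 - cosZ (k j)) + 4 * beta + 8 * gap ^+ 2 / delta * (slow_count k)%:R.
Proof.
have [b0 d0 bd g0] := rates_gt0.
have c0 : 0 <= 1 - cosZ (k j) :> R := symbol_summand_ge0 k j.
have cs := one_sub_cosZ_le_symbol k j.
have r0 : 0 <= 8 * gap ^+ 2 / delta by rewrite divr_ge0 ?mulr_ge0 ?sqr_ge0 // ltW.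
have rs0 : 0 <= 8 * gap ^+ 2 / delta * (slow_count k)%:R by rewrite mulr_ge0.
move: c0 cs; set c := 1 - cosZ _ => c0 cs.
rewrite /mode_weight; case: (symbol_cases k) => [[_ e]|[e sc]|h].
- by rewrite e mulr0 mul0r mul0r; lra.
- rewrite e in cs *; have -> : 2 * gap - beta = delta by lra.
  have h1 : 8 * gap / delta * c <= 8 * gap ^+ 2 / delta.
    rewrite [leRHS](_ : _ = 8 * gap / delta * gap); last by field; rewrite gt_eqF.
    by rewrite ler_wpM2l // divr_ge0 ?ltW //; lra.
  have : 8 * gap ^+ 2 / delta * 1 <= 8 * gap ^+ 2 / delta * (slow_count k)%:R.
    by rewrite ler_wpM2l // ler1n.
  lra.
- suff : 8 * symbol R k / (2 * symbol R k - beta) * c <= 4 * c + 4 * beta by lra.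
  rewrite mulrAC ler_pdivrMr; last lra.
  rewrite -subr_ge0 (_ : _ - _ = 4 * beta * (2 * symbol R k - beta - c)); last by ring.
  by rewrite mulr_ge0; lra.
Qed.

Let Nd0 : 0 < (N ^ d)%:R :> R. Proof. by rewrite ltr0n expn_gt0 (ltnW N1). Qed.

Let card_torus (c : R) : \sum_(k : torus d N) c = (N ^ d)%:R * c.
Proof.
by rewrite sumr_const cardT -cardE card_ffun !card_ord Zp_cast // mulr_natl.
Qed.

Lemma sum_mode_weight_le :
  (N ^ d)%:R^-1 * \sum_k mode_weight k <=
  8 + 16 * d%:R * gap / (delta * (N ^ d)%:R).
Proof.
rewrite mulrC ler_pdivrMr //.
apply: (@le_trans _ _ (\sum_k (8 + 8 * gap / delta * (slow_count k)%:R))).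
  by apply: ler_sum => k _; exact: mode_weight_le.
rewrite big_split /= card_torus -mulr_sumr sum_slow_count natrM le_eqVlt.
by apply/orP; left; apply/eqP; field; rewrite !gt_eqF.
Qed.

Lemma sum_mode_weight_gradient_le x y : torus_dist x y == 1%N ->
  (N ^ d)%:R^-1 * \sum_k mode_weight k * (1 - cosZ (phase k x - phase k y)) <=
  4 + 4 * beta + 16 * d%:R * gap ^+ 2 / (delta * (N ^ d)%:R).
Proof.
move=> xy; have xny := torus_dist1_neq xy.
have [j [a [a1 yE]]] := torus_dist1P R N4 xy.
rewrite mulrC ler_pdivrMr //.
apply: (@le_trans _ _ (\sum_k (4 * (1 - cosZ (phase k x - phase k y)) + 4 * beta +
   8 * gap ^+ 2 / delta * (slow_count k)%:R))).
  apply: ler_sum => k _.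
  have -> : cosZ (phase k x - phase k y) = cosZ (k j) :> R.
    by rewrite yE phase_step_sub //; case: a1 => ->; rewrite ?mulr1 // mulrN1 cosZN.
  exact: mode_weight_gradient_le.
rewrite !big_split /= -!mulr_sumr sumrB !card_torus wave_orthogonal //.
rewrite (negPf xny) mulr0 subr0.
rewrite sum_slow_count natrM le_eqVlt.
by apply/orP; left; apply/eqP; field; rewrite !gt_eqF.
Qed.

Let E := @prob_configs R d N.
Variable S : R -> (config R d N -> R) -> config R d N -> R.
Hypothesis semiS : markov_semigroup E S.
Hypothesis genS : has_generator E S (@averaging_generator R d N).
Local Notation eta0 := (unit_mass R (origin d N)).
Local Notation pm := (pairing_moment S eta0).
Local Notation gm := (gradient_moment S eta0).

Definition dirichlet_moment s : R :=
  \sum_(x : torus d N) \sum_(y : torus d N | torus_dist x y == 1%N) gm s x y.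

(** The rate is [beta / 2] because the moment is quadratic. Putting the exponential into the test
    function lets [pairing_moment_forward_derivable] apply directly, and [s - 0] is the shape of
    [forward_derivable_expR]. *)
Let mode s b k z : R := expR (beta / 2 * (s - 0)) * wave R b k z.

Definition lyapunov s : R :=
  (N ^ d)%:R^-1 * \sum_k mode_weight k * \sum_b pm s (mode s b k).

Definition dlyapunov s : R :=
  (N ^ d)%:R^-1 * \sum_k mode_weight k * \sum_b
    (2 * (beta / 2 - symbol R k) * pm s (mode s b k) +
     8^-1 * \sum_(x : torus d N) \sum_(y : torus d N | torus_dist x y == 1%N)
       (mode s b k x - mode s b k y) ^+ 2 * gm s x y).

Lemma lyapunov_derivable : forward_derivable lyapunov dlyapunov.
Proof.
apply: forward_derivableZ; apply: forward_derivable_sum => k _.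
apply: forward_derivableZ; apply: forward_derivable_sum => b _.
apply: (pairing_moment_forward_derivable N1 semiS genS (unit_mass_prob R d N)
  (g := fun s => mode s b k)
  (dg := fun s z => beta / 2 * expR (beta / 2 * (s - 0)) * wave R b k z +
    expR (beta / 2 * (s - 0)) * 0)).
  move=> z; apply: forward_derivableM; first exact: forward_derivable_expR.
  exact: forward_derivable_cst.
move=> s z s0.
by rewrite torus_laplacianZ torus_laplacian_wave // /mode; ring.
Qed.

Lemma lyapunov0 : lyapunov 0 = (N ^ d)%:R^-1 * \sum_k mode_weight k.
Proof.
congr (_ * _); apply: eq_bigr => k _; rewrite -[RHS]mulr1; congr (_ * _).
rewrite -(sum_wave_sqr R k (origin d N)); apply: eq_bigr => b _.
by rewrite pairing_moment0 // /mode subrr mulr0 expR0 mul1r.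
Qed.

Lemma lyapunov_ge0 s : 0 <= s -> 0 <= lyapunov s.
Proof.
move=> s0; rewrite mulr_ge0 ?invr_ge0 //; apply: sumr_ge0 => k _.
rewrite mulr_ge0 ?mode_weight_ge0 //; apply: sumr_ge0 => b _.
exact: pairing_moment_ge0.
Qed.

(** By [mode_weightE] and Parseval the decay of the modes yields - 2 e^(beta s) times the Dirichlet
    moment. The gradient term gives back at most 6/4 of the same quantity, and 1/2 is left. *)
Lemma dlyapunov_le s : 0 <= s ->
  4 + 4 * beta + 16 * d%:R * gap ^+ 2 / (delta * (N ^ d)%:R) <= 6 ->
  dlyapunov s <= - (2^-1 * (expR (beta * s) * dirichlet_moment s)).
Proof.
move=> s0 small.
set e := expR (beta * s).
have e0 : 0 < e by rewrite expR_gt0.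
have eE : expR (beta / 2 * (s - 0)) ^+ 2 = e.
  by rewrite -expRM_natl; congr expR; lra.
have modeE b k : pm s (mode s b k) = e * pm s (wave R b k).
  by rewrite -eE; exact: pairing_momentZ.
have -> : dlyapunov s =
   - (8 * e) * ((N ^ d)%:R^-1 * \sum_k symbol R k * \sum_b pm s (wave R b k)) +
   e / 4 * \sum_(x : torus d N) \sum_(y : torus d N | torus_dist x y == 1%N)
     gm s x y * ((N ^ d)%:R^-1 * \sum_k mode_weight k * (1 - cosZ (phase k x - phase k y))).
  transitivity ((N ^ d)%:R^-1 * \sum_k
    (- (8 * e) * (symbol R k * \sum_b pm s (wave R b k)) +
    e / 4 * (mode_weight k * \sum_(x : torus d N) \sum_(y : torus d N | torus_dist x y == 1%N)
      gm s x y * (1 - cosZ (phase k x - phase k y))))).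
    congr (_ * _); apply: eq_bigr => k _.
    transitivity (e * (mode_weight k * (beta - 2 * symbol R k)) * \sum_b pm s (wave R b k) +
      e / 4 * (mode_weight k * \sum_(x : torus d N) \sum_(y : torus d N | torus_dist x y == 1%N)
        gm s x y * (1 - cosZ (phase k x - phase k y)))); last first.
      by rewrite mode_weightE; ring.
    rewrite big_split /= mulrDr; congr (_ + _).
      rewrite -mulr_sumr; under [in LHS]eq_bigr do rewrite modeE.
      by rewrite -mulr_sumr; field.
    rewrite [RHS]mulrCA; congr (_ * _); rewrite -mulr_sumr exchange_big !mulr_sumr.
    apply: eq_bigr => x _ /=; rewrite exchange_big !mulr_sumr; apply: eq_bigr => y _ /=.
    rewrite -mulr_suml; under eq_bigr do rewrite /mode -mulrBr exprMn.
    by rewrite -mulr_sumr eE sum_wave_gradient //; field.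
  rewrite big_split /= mulrDr -!mulr_sumr; congr (_ + _); first by rewrite mulrCA.
  rewrite mulrCA; congr (_ * _); under [in LHS]eq_bigr do rewrite mulr_sumr.
  rewrite [in LHS]exchange_big mulr_sumr; apply: eq_bigr => x _ /=.
  under [in LHS]eq_bigr do rewrite mulr_sumr.
  rewrite [in LHS]exchange_big mulr_sumr; apply: eq_bigr => y _ /=.
  rewrite [RHS]mulrCA; congr (_ * _); rewrite mulr_sumr.
  by apply: eq_bigr => k _; rewrite mulrCA.
rewrite pairing_moment_parseval // -/(dirichlet_moment s).
have h : \sum_(x : torus d N) \sum_(y : torus d N | torus_dist x y == 1%N)
     gm s x y * ((N ^ d)%:R^-1 * \sum_k mode_weight k * (1 - cosZ (phase k x - phase k y))) <=
   6 * dirichlet_moment s.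
  rewrite mulr_sumr; apply: ler_sum => x _; rewrite mulr_sumr; apply: ler_sum => y xy.
  rewrite mulrC ler_wpM2r ?gradient_moment_ge0 //.
  exact: le_trans (sum_mode_weight_gradient_le xy) small.
have : e / 4 * (\sum_(x : torus d N) \sum_(y : torus d N | torus_dist x y == 1%N)
     gm s x y * ((N ^ d)%:R^-1 * \sum_k mode_weight k * (1 - cosZ (phase k x - phase k y))))
   <= e / 4 * (6 * dirichlet_moment s).
  by rewrite ler_pM2l // divr_gt0.
lra.
Qed.

End lyapunov.

(** * Duhamel formula and bootstrap *)

Section duhamel.
Variables (R : realType) (d N : nat).
Hypothesis N4 : (3 < N)%N.
Let N1 : (1 < N)%N. Proof. exact: leq_trans N4. Qed.
Implicit Types (x y z k : torus d N) (s t : R).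
Local Notation gap := (1 - @cosZ R N 1).
Variables beta delta : R.
Hypothesis beta_gt0 : 0 < beta.
Hypothesis delta_gt0 : 0 < delta.
Hypothesis beta_delta : beta + delta = 2 * gap.
Hypothesis small :
  4 + 4 * beta + 16 * d%:R * gap ^+ 2 / (delta * (N ^ d)%:R) <= 6.
Let E := @prob_configs R d N.
Variable S : R -> (config R d N -> R) -> config R d N -> R.
Hypothesis semiS : markov_semigroup E S.
Hypothesis genS : has_generator E S (@averaging_generator R d N).
Local Notation eta0 := (unit_mass R (origin d N)).
Local Notation pm := (pairing_moment S eta0).
Local Notation gm := (gradient_moment S eta0).
Local Notation mn u := (Num.min (N%:R ^+ 2) u).
Local Notation K := (34 ^+ 2 * 81 ^+ d.-1 : R).

Lemma torus_laplacianB (f g : torus d N -> R) z :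
  torus_laplacian (fun z => f z - g z) z = torus_laplacian f z - torus_laplacian g z.
Proof.
rewrite /torus_laplacian -mulrBr -sumrB; congr (_ * _).
by apply: eq_bigr => w _; lra.
Qed.

Lemma gradient_moment_duhamel t th A x y : 0 < th <= t -> torus_dist x y == 1%N ->
  (forall s x' y', t - th <= s <= t -> torus_dist x' y' == 1%N -> gm s x' y' <= A) ->
  gm t x y <= K / mn t ^+ d.+1 * expR (- gap * t) ^+ 2 +
    K / mn th ^+ d.+1 * expR (- beta * t) * lyapunov beta S 0 + A / 2.
Proof.
move=> /andP[th0 tht] xy gmA.
have t0 : 0 < t := lt_le_trans th0 tht.
have tt0 : 0 <= t - th by lra.
pose g s z := heat (t - s) x z - heat (t - s) y z.
pose dg s z := - torus_laplacian (g s) z.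
have gP z : forward_derivable (g ^~ z) (dg ^~ z).
  have := forward_derivableD (heat_backward_derivable N4 t x z)
    (forward_derivableZ (-1) (heat_backward_derivable N4 t y z)).
  rewrite (_ : (fun s => _ + _) = g ^~ z); last by apply/funext => s; rewrite mulN1r.
  by move/forward_derivable_ext; apply => s _; rewrite /dg torus_laplacianB; lra.
have eqg s z : 0 < s -> dg s z + torus_laplacian (g s) z = 0 * g s z.
  by move=> _; rewrite /dg mul0r addNr.
have PhiP := pairing_moment_forward_derivable N1 semiS genS (unit_mass_prob R d N) gP eqg.
set Phi := fun s => pm s (g s) in PhiP.
set dPhi := fun s => _ in PhiP.
have dPhiE s : dPhi s = 8^-1 *
  \sum_(x : torus d N) \sum_(y : torus d N | torus_dist x y == 1%N)
    (g s x - g s y) ^+ 2 * gm s x y by rewrite /dPhi mulr0 mul0r add0r.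
have gt : g t = fun z => (z == x)%:R - (z == y)%:R.
  by apply/funext => z; rewrite /g subrr !heat0.
have Phit : Phi t = gm t x y by rewrite /Phi gt -gradient_momentE // ltW.
have Phi0 : Phi 0 <= K / mn t ^+ d.+1 * expR (- gap * t) ^+ 2.
  by rewrite /Phi pairing_moment0 // /g subr0; exact: heat_gradient_sqr_le.
pose G s := \sum_z g s z * g s z.
pose dG s := \sum_z (dg s z * g s z + g s z * dg s z).
have GP : forward_derivable G dG.
  by apply: forward_derivable_sum => z _; apply: forward_derivableM.
have dGE s : dG s = 2^-1 * \sum_(x : torus d N) \sum_(y : torus d N | torus_dist x y == 1%N)
    (g s x - g s y) ^+ 2.
  have := sum_gradients N1 (g s) (g s) => e.
  under eq_bigr do under eq_bigr do rewrite expr2.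
  rewrite e /dG /pairing mulr_sumr mulr_sumr; apply: eq_bigr => z _; rewrite /dg; lra.
have Gt : G t = 2.
  have xny := negbTE (torus_dist1_neq xy).
  rewrite /G gt sum_indicator_sub !eqxx xny eq_sym xny /=; lra.
have G_ge0 s : 0 <= G s by apply: sumr_ge0 => z _; rewrite -expr2 sqr_ge0.
(* On the window [dPhi] is at most [A / 4 * dG], the quotient of the constants 1/8 and 1/2, and
   [G t = 2]. *)
have near : Phi t - Phi (t - th) <= A / 2.
  have itv : 0 <= t - th <= t by lra.
  have := forward_derivable_le PhiP (forward_derivableZ (A / 4) GP) itv.
  have A0 : 0 <= A.
    apply: le_trans (gmA t x y _ xy); first exact: gradient_moment_ge0 (ltW t0).
    by lra.
  have h : forall s : R, t - th < s < t -> dPhi s <= A / 4 * dG s.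
    move=> s /andP[s1 s2]; rewrite dPhiE dGE.
    have : \sum_(x : torus d N) \sum_(y : torus d N | torus_dist x y == 1%N)
        (g s x - g s y) ^+ 2 * gm s x y <=
      A * \sum_(x : torus d N) \sum_(y : torus d N | torus_dist x y == 1%N)
        (g s x - g s y) ^+ 2.
      rewrite mulr_sumr; apply: ler_sum => x' _; rewrite mulr_sumr.
      apply: ler_sum => y' xy'; rewrite mulrC ler_wpM2r ?sqr_ge0 //.
      by apply: gmA => //; rewrite !ltW.
    lra.
  move=> /(_ h); rewrite Gt; have := mulr_ge0 A0 (G_ge0 (t - th)); lra.
set Kth := K / mn th ^+ d.+1.
have m0 (u : R) : 0 < u -> 0 < mn u.
  by move=> u0; rewrite lt_min u0 exprn_gt0 // ltr0n ltnW.
have Kth0 : 0 <= Kth.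
  by rewrite /Kth divr_ge0 ?mulr_ge0 ?exprn_ge0 // ltW // m0.
set Q := Kth * expR (- beta * t).
have Q0 : 0 <= Q by rewrite /Q mulr_ge0 // expR_ge0.
(* Before the window, squared differences of [g] are at most 4 times its squared supremum. The
   factor 1/8 then leaves the 1/2 with which the Lyapunov function dissipates the Dirichlet moment,
   so [- Q] times this function grows at least as fast as [Phi]. *)
have far : Phi (t - th) - Phi 0 <= Q * lyapunov beta S 0.
  have itv : (0 : R) <= 0 <= t - th by rewrite lexx.
  have LyP := lyapunov_derivable N4 beta semiS genS.
  have := forward_derivable_le PhiP (forward_derivableZ (- Q) LyP) itv.
  have h : forall s : R, 0 < s < t - th -> dPhi s <= - Q * dlyapunov beta S s.
    move=> s /andP[s0 s1].
    have us : th <= t - s by lra.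
    have us0 : 0 < t - s by lra.
    pose D := Kth * expR (- gap * (t - s)) ^+ 2.
    have gD z : g s z ^+ 2 <= D.
      apply: le_trans (heat_gradient_sqr_le N4 z us0 xy) _.
      rewrite ler_wpM2r ?sqr_ge0 // ler_wpM2l ?mulr_ge0 ?exprn_ge0 //.
      rewrite lef_pV2 ?posrE ?exprn_gt0 ?m0 // lerXn2r // ?nnegrE ?(ltW (m0 _ _)) //.
      by rewrite le_min !ge_min lexx us /= orbT.
    (* The kernel decays at rate 2 gap, the Lyapunov function at rate [beta] only; the positive
       [delta] is given away here. *)
    have DQ : D <= Q * expR (beta * s).
      rewrite /D /Q -[leRHS]mulrA ler_wpM2l // -expRM_natl -expRD ler_expR.
      rewrite (_ : 2%:R * (- gap * (t - s)) = - (2 * gap) * (t - s)); last by ring.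
      rewrite -beta_delta; have := mulr_gt0 delta_gt0 us0; lra.
    have dL := dlyapunov_le N4 beta_gt0 delta_gt0 beta_delta semiS (ltW s0) small.
    have : Q * dlyapunov beta S s <=
        Q * - (2^-1 * (expR (beta * s) * dirichlet_moment S s)).
      by rewrite ler_wpM2l.
    rewrite dPhiE.
    have : \sum_(x : torus d N) \sum_(y : torus d N | torus_dist x y == 1%N)
        (g s x - g s y) ^+ 2 * gm s x y <= 4 * (Q * expR (beta * s)) * dirichlet_moment S s.
      rewrite /dirichlet_moment mulr_sumr; apply: ler_sum => x' _.
      rewrite mulr_sumr; apply: ler_sum => y' _.
      rewrite ler_wpM2r ?gradient_moment_ge0 ?(ltW s0) //.
      have := gD x'; have := gD y'; have := sqr_ge0 (g s x' + g s y'); nra.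
    lra.
  have Ly0 := lyapunov_ge0 N4 beta_gt0 delta_gt0 beta_delta semiS tt0.
  by move=> /(_ h); have := mulr_ge0 Q0 Ly0; lra.
by rewrite -Phit; lra.
Qed.

End duhamel.

Lemma bernoulli_inequality (R : realDomainType) (e : R) (n : nat) : 0 <= e <= 1 ->
  1 - n%:R * e <= (1 - e) ^+ n.
Proof.
move=> /andP[e0 e1]; elim: n => [|n IH]; first by rewrite mul0r subr0 expr0.
rewrite exprS; have : (1 - e) * (1 - n%:R * e) <= (1 - e) * (1 - e) ^+ n.
  by rewrite ler_wpM2l // subr_ge0.
apply: le_trans; rewrite -natr1 -subr_ge0.
rewrite (_ : _ - _ = n%:R * e ^+ 2); last by ring.
by rewrite mulr_ge0 // sqr_ge0.
Qed.

Section bootstrap.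
Variables (R : realType) (d N : nat).
Hypothesis N4 : (3 < N)%N.
Let N1 : (1 < N)%N. Proof. exact: leq_trans N4. Qed.
Let Nneq0 : N%:R != 0 :> R. Proof. by rewrite pnatr_eq0; lia. Qed.
Implicit Types (x y : torus d N) (s t : R).
Local Notation gap := (1 - @cosZ R N 1).
Variables beta delta : R.
Hypothesis beta_gt0 : 0 < beta.
Hypothesis delta_gt0 : 0 < delta.
Hypothesis beta_delta : beta + delta = 2 * gap.
Hypothesis beta_le1 : beta <= 1.
Hypothesis small :
  4 + 4 * beta + 16 * d%:R * gap ^+ 2 / (delta * (N ^ d)%:R) <= 6.
Let E := @prob_configs R d N.
Variable S : R -> (config R d N -> R) -> config R d N -> R.
Hypothesis semiS : markov_semigroup E S.
Hypothesis genS : has_generator E S (@averaging_generator R d N).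
Variable CL : R.
Hypothesis lyapunov_le : lyapunov beta S 0 <= CL.
Local Notation gm := (gradient_moment S (unit_mass R (origin d N))).
Local Notation mn u := (Num.min (N%:R ^+ 2) u).
Local Notation K := (34 ^+ 2 * 81 ^+ d.-1 : R).

Definition time_scale s : R := Num.max 1 (mn s).
(** Up to a constant the reciprocal of the bound to be proved, which thus becomes the boundedness of
    [decay_weight] times [gradient_moment]. *)
Definition decay_weight s : R := time_scale s ^+ d.+1 * expR (beta * s).
(* Small enough that [(1 - window)^(d+1) * expR (- 64 * window) >= 2/3], the factor
   by which [decay_weight] can drop over [window * mn t]. *)
Definition window : R := (3 * (d%:R + 65))^-1.
(** The two summands with [K] come from the Duhamel bound, for its initial term and for the times
    before the window; [expR 1] covers the times up to 1, where [beta <= 1]. *)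
Definition bootstrap_const : R := K * (1 + CL / window ^+ d.+1) + expR 1.

Let window_gt0 : 0 < window.
Proof. by rewrite invr_gt0 mulr_gt0 // ltr_wpDl. Qed.

Let windowE : (d%:R + 65) * window = 3^-1.
Proof. by rewrite /window; field; rewrite gt_eqF // ltr_wpDl. Qed.

Let window_le1 : window <= 1.
Proof.
have := windowE; have := window_gt0; have : 0 <= d%:R :> R by []. nra.
Qed.

Let time_scale_ge1 s : 1 <= time_scale s.
Proof. by rewrite le_max lexx. Qed.

Lemma decay_weight_gt0 s : 0 < decay_weight s.
Proof.
by rewrite mulr_gt0 ?expR_gt0 // exprn_gt0 // (lt_le_trans _ (time_scale_ge1 s)).
Qed.

Let Nsq1 : 1 <= N%:R ^+ 2 :> R.
Proof. by rewrite -natrX ler1n expn_gt0; lia. Qed.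

(** The polynomial factor loses (d + 1) [window] by Bernoulli and the exponential loses 64 [window],
    so a fraction 1 - (d + 65) [window] = 2/3 remains. *)
Lemma decay_weight_window s t : 1 <= t -> t - window * mn t <= s <= t ->
  decay_weight t <= 3 / 2 * decay_weight s.
Proof.
move=> t1 /andP[ts st]; set mu := mn t in ts *.
have mu1 : 1 <= mu by rewrite le_min Nsq1.
have muN : mu <= N%:R ^+ 2 by rewrite ge_min lexx.
have mut : mu <= t by rewrite ge_min lexx orbT.
have w0 := window_gt0; have w1 := window_le1; have wE := windowE.
have b0 := beta_gt0; have d0 := delta_gt0; have bd := beta_delta.
have tst : time_scale t = mu by rewrite /time_scale max_r.
have scale : (1 - window) * mu <= time_scale s.
  rewrite /time_scale le_max le_min; apply/orP; right; apply/andP; split; nra.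
have pow : (1 - d.+1%:R * window) * mu ^+ d.+1 <= time_scale s ^+ d.+1.
  apply: (@le_trans _ _ (((1 - window) * mu) ^+ d.+1)).
    rewrite exprMn ler_wpM2r ?exprn_ge0 //; first lra.
    by apply: bernoulli_inequality; rewrite ltW.
  rewrite lerXn2r // nnegrE; first by apply: mulr_ge0; lra.
  by apply: le_trans (time_scale_ge1 s).
(* Capping the window at [window] times N^2 pays off here, since [beta] is at most 2 gap, hence at
   most 64 / N^2. *)
have drift : beta * (t - s) <= 64 * window.
  have g : gap <= 32 / N%:R ^+ 2.
    by have := @one_sub_cosZ_le R N N1 1; rewrite zabs1 // expr1n mulr1.
  have bg : beta <= 64 / N%:R ^+ 2.
    rewrite (_ : 64 / _ = 2 * (32 / N%:R ^+ 2)); first lra.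
    by rewrite mulrA; congr (_ / _); lra.
  apply: (@le_trans _ _ (64 / N%:R ^+ 2 * (window * N%:R ^+ 2))).
    apply: ler_pM => //; [exact: ltW|lra|].
    have : window * mu <= window * N%:R ^+ 2 by rewrite ler_pM2l.
    lra.
  rewrite le_eqVlt; apply/orP; left; apply/eqP; field.
  exact: Nneq0.
have ex : (1 - 64 * window) * expR (beta * t) <= expR (beta * s).
  rewrite (_ : beta * s = - (beta * (t - s)) + beta * t); last by ring.
  rewrite expRD ler_pM2r ?expR_gt0 //; apply: le_trans (expR_ge1Dx _); lra.
have d1 : d.+1%:R * window <= 1.
  by rewrite -natr1; have : 0 <= d%:R :> R by []; nra.
have d2 : 64 * window <= 1 by have : 0 <= d%:R :> R by []; nra.
have : ((1 - d.+1%:R * window) * mu ^+ d.+1) * ((1 - 64 * window) * expR (beta * t)) <=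
    decay_weight s.
  apply: ler_pM => //; apply: mulr_ge0; rewrite ?expR_ge0 ?exprn_ge0 //; lra.
rewrite mulrACA /decay_weight tst -/(decay_weight s) => h.
have W0 : 0 <= mu ^+ d.+1 * expR (beta * t).
  by rewrite mulr_ge0 ?expR_ge0 // exprn_ge0 //; lra.
have : 2 / 3 * (mu ^+ d.+1 * expR (beta * t)) <= decay_weight s.
  apply: le_trans h; rewrite ler_wpM2r // -natr1.
  have : 0 <= (d%:R + 1) * window * (64 * window) by rewrite !mulr_ge0 // ltW.
  lra.
lra.
Qed.

Lemma bootstrap_step (T r : R) : 0 <= r ->
  (forall s x y, 0 <= s <= T -> torus_dist x y == 1%N -> decay_weight s * gm s x y <= r) ->
  forall t x y, 0 <= t <= T -> torus_dist x y == 1%N ->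
    decay_weight t * gm t x y <= bootstrap_const + 3 / 4 * r.
Proof.
move=> r0 hr t x y /andP[t0 tT] xy.
have b0 := beta_gt0; have d0 := delta_gt0; have bd := beta_delta; have b1 := beta_le1.
have w0 := window_gt0; have w1 := window_le1.
have Ly0 : 0 <= lyapunov beta S 0.
  exact: (lyapunov_ge0 N4 beta_gt0 delta_gt0 beta_delta semiS (lexx 0)).
have CL0 : 0 <= CL := le_trans Ly0 lyapunov_le.
have K0 : 0 <= K by rewrite mulr_ge0 // exprn_ge0.
have KC0 : 0 <= K * (1 + CL / window ^+ d.+1).
  by rewrite mulr_ge0 // addr_ge0 // divr_ge0 // exprn_ge0 // ltW.
(* The window argument needs min(N^2, t) at least 1; earlier the moment is at most 1 and the weight
   at most [expR 1]. *)
have [t1|t1] := leP t 1.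
  have -> : decay_weight t = expR (beta * t).
    by rewrite /decay_weight /time_scale max_l ?expr1n ?mul1r // ge_min t1 orbT.
  have : expR (beta * t) * gm t x y <= expR 1 * 1.
    apply: ler_pM; rewrite ?expR_ge0 ?gradient_moment_ge0 ?gradient_moment_le1 //.
    by rewrite ler_expR; nra.
  by rewrite /bootstrap_const; lra.
set mu := mn t.
have mu1 : 1 <= mu by rewrite le_min Nsq1 ltW.
have muN : mu <= N%:R ^+ 2 by rewrite ge_min lexx.
have mut : mu <= t by rewrite ge_min lexx orbT.
have mu0 : 0 < mu by lra.
have W0 := decay_weight_gt0 t.
have itv : 0 < window * mu <= t.
  by apply/andP; split; [exact: mulr_gt0 | nra].
(* Within the window the weight has dropped by at most 3/2, which gives this [A]; the half from
   Duhamel turns it into 3/4. *)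
have := gradient_moment_duhamel N4 beta_gt0 delta_gt0 beta_delta small semiS genS itv xy
  (A := 3 / 2 * r / decay_weight t).
have mnw : mn (window * mu) = window * mu by rewrite min_r //; nra.
rewrite mnw -/mu => /(_ _) h.
have {}h : gm t x y <= K / mu ^+ d.+1 * expR (- gap * t) ^+ 2 +
    K / (window * mu) ^+ d.+1 * expR (- beta * t) * lyapunov beta S 0 +
    3 / 2 * r / decay_weight t / 2.
  apply: h => s x' y' /andP[s1 s2] xy'.
  have s0 : 0 <= s by have /andP[_ ?] := itv; lra.
  rewrite ler_pdivlMr // mulrC.
  have := hr s x' y' _ xy'; rewrite s0 (le_trans s2 tT) => /(_ isT) h1.
  have h2 : decay_weight t <= 3 / 2 * decay_weight s.
    by apply: decay_weight_window; [exact: ltW | rewrite s1 s2].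
  have := ler_wpM2r (gradient_moment_ge0 semiS x' y' s0) h2; lra.
apply: le_trans (ler_wpM2l (ltW W0) h) _.
have WE : decay_weight t = mu ^+ d.+1 * expR (beta * t).
  by rewrite /decay_weight /time_scale max_r.
have mud0 : 0 < mu ^+ d.+1 by exact: exprn_gt0.
have wd0 : 0 < window ^+ d.+1 by exact: exprn_gt0.
rewrite !mulrDr.
have -> : decay_weight t * (3 / 2 * r / decay_weight t / 2) = 3 / 4 * r.
  by field; rewrite gt_eqF.
rewrite lerD2r.
have e1 : 0 <= expR 1 :> R by exact: expR_ge0.
have a1 : decay_weight t * (K / mu ^+ d.+1 * expR (- gap * t) ^+ 2) <= K.
  rewrite (_ : _ * _ = K * (expR (beta * t) * expR (- gap * t) ^+ 2)); last first.
    by rewrite WE; field; rewrite gt_eqF.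
  rewrite ler_piMr // -expRM_natl -expRD -[leRHS]expR0 ler_expR.
  rewrite [leLHS](_ : _ = - (2 * gap - beta) * t); last by ring.
  rewrite (_ : 2 * gap - beta = delta); last lra.
  by rewrite mulNr oppr_le0 mulr_ge0 // ltW.
have a2 : decay_weight t *
    (K / (window * mu) ^+ d.+1 * expR (- beta * t) * lyapunov beta S 0) <=
    K * (CL / window ^+ d.+1).
  rewrite (_ : _ * _ = K * (lyapunov beta S 0 / window ^+ d.+1) *
      (expR (beta * t) * expR (- beta * t))); last first.
    by rewrite WE exprMn; field; rewrite !gt_eqF.
  rewrite mulNr -expRD subrr expR0 mulr1 ler_wpM2l //.
  by rewrite ler_pM2r // invr_gt0.
by rewrite /bootstrap_const; lra.
Qed.

(** The supremum over [0, t] is at most the constant plus 3/4 of itself. It is taken on [0, t]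
    because the a priori bound that makes it finite grows with [t]; the resulting constant does
    not. *)
Lemma gradient_moment_le t x y : 0 <= t -> torus_dist x y == 1%N ->
  decay_weight t * gm t x y <= 4 * bootstrap_const.
Proof.
move=> t0 xy.
pose A : set R := [set r | exists s x' y',
  [/\ 0 <= s <= t, torus_dist x' y' == 1%N & r = decay_weight s * gm s x' y']].
have At : A (decay_weight t * gm t x y) by exists t, x, y; rewrite lexx t0.
have Aub : has_ubound A.
  exists (Num.max 1 (N%:R ^+ 2) ^+ d.+1 * expR (beta * t) * 1).
  move=> _ [s [x' [y' [/andP[s0 st] xy' ->]]]].
  have b0 := beta_gt0.
  have Ws := ltW (decay_weight_gt0 s).
  apply: ler_pM; rewrite ?gradient_moment_le1 ?gradient_moment_ge0 ?Ws //.
  apply: ler_pM; rewrite ?expR_ge0 ?exprn_ge0 //.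
  - exact: le_trans (time_scale_ge1 s).
  - rewrite lerXn2r // ?nnegrE ?(le_trans _ (time_scale_ge1 s)) //.
    rewrite /time_scale ge_max !le_max lexx /=; apply/orP; right.
    by rewrite ge_min lexx.
  - by rewrite ler_expR ler_pM2l.
have supA : has_sup A by split => //; exists (decay_weight t * gm t x y).
have ubA r : A r -> r <= sup A by move=> Ar; exact: ub_le_sup.
have sup0 : 0 <= sup A.
  apply: le_trans (ubA _ At); rewrite mulr_ge0 ?gradient_moment_ge0 //.
  exact/ltW/decay_weight_gt0.
have step := @bootstrap_step t (sup A) sup0 (fun s x y st xy =>
  ubA _ (ex_intro _ s (ex_intro _ x (ex_intro _ y (And3 st xy erefl))))).
have : sup A <= bootstrap_const + 3 / 4 * sup A.
  apply: ge_sup; first by exists (decay_weight t * gm t x y).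
  by move=> _ [s [x' [y' [st xy' ->]]]]; exact: step.
have := ubA _ At; lra.
Qed.

End bootstrap.

(** * Choice of the constants *)

Theorem proposition2p2 (R : realType) (d : nat) (hd : (1 <= d)%N) :
  exists B C : R, 0 < B /\ 0 < C /\
  exists N0 : nat, forall N : nat, (N0 <= N)%N ->
  forall (disp : measure_display) (Omega : measurableType disp)
    (P : probability Omega R) (eta : R -> Omega -> config R d N),
  averaging_process P (unit_mass R (origin d N)) eta ->
  forall (t : R), 0 <= t ->
  forall x y : torus d N, torus_dist x y = 1%N ->
  ('E_P[fun w => ((eta t w x - eta t w y) ^+ 2)%R] <=
   (C / Num.max (Num.min (N%:R ^+ (2 * d + 2)) (t ^+ (d + 1))) 1 *
    expR (- (2 * t / relaxation_time R N) + B * t / N%:R ^+ (d + 2)))%R%:E)%E.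
Proof.
(* The bound of [sum_mode_weight_le] with 1 / (delta N^d) = N^2 and gap N^2 at most 32. *)
pose CL : R := 8 + 16 * (32 * d%:R).
have CL0 : 0 <= CL by rewrite addr_ge0 // !mulr_ge0.
have C0 : 0 < 4 * bootstrap_const d CL.
  rewrite mulr_gt0 // ltr_wpDl ?expR_gt0 // !mulr_ge0 ?exprn_ge0 // addr_ge0 //.
  by rewrite divr_ge0 // exprn_ge0 // invr_ge0 mulr_ge0 // addr_ge0.
(* [B] is 1 because [delta] will be exactly 1 / N^(d+2). *)
exists 1, (4 * bootstrap_const d CL); split=> //; split=> //.
(* This makes 128^2 (d + 1) / N^2 at most 1. The two terms added to 4 in [small] are at most 256 /
   N^2 and 128^2 d / N^2, so they fit below 2. *)
exists (128 * d.+1)%N => N hN disp Omega P eta etaP t t0 x y /eqP xy.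
have N4 : (3 < N)%N by lia.
have N1 : (1 < N)%N by lia.
have e22 : (2 * d + 2 = 2 * d.+1)%N by lia.
have [S [semiS genS ES]] := markov_jump_process_expectation (unit_mass_prob R d N) etaP.
rewrite (ES t (fun h : config R d N => (h x - h y) ^+ 2) t0) ?lee_fin; last first.
  exact: gradient_continuous.
rewrite -/(gradient_moment S (unit_mass R (origin d N)) t x y).
set n : R := N%:R.
have n1 : 1 < n by rewrite ltr1n.
have n0 : 0 < n by lra.
have nbig : 128 * (128 * (d%:R + 1)) <= n ^+ 2.
  have : 128 * (d%:R + 1) <= n.
    by rewrite natr1 -natrM ler_nat.
  by have : 0 <= d%:R :> R by []; nra.
set gap := 1 - @cosZ R N 1.
have gap_le : gap <= 32 / n ^+ 2.
  by have := @one_sub_cosZ_le R N N1 1; rewrite zabs1 // expr1n mulr1.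
have gap_ge : 1 / (2 * n ^+ 2) <= gap.
  by have := @one_sub_cosZ_ge R N N1 1; rewrite zabs1 // expr1n.
have gap0 : 0 < gap := gap_gt0 R N4.
set delta := (n ^+ (d + 2))^-1.
have delta0 : 0 < delta by rewrite invr_gt0 exprn_gt0.
have deltaN : delta * (N ^ d)%:R = (n ^+ 2)^-1.
  rewrite /delta exprD natrX -/n; field.
  by rewrite !expf_neq0 // gt_eqF.
have n2inv : n ^+ 2 * (n ^+ 2)^-1 = 1 by rewrite divff // expf_neq0 // gt_eqF.
have n2i0 : 0 < (n ^+ 2)^-1 by rewrite invr_gt0 exprn_gt0.
set v := (n ^+ 2)^-1 in n2inv n2i0 gap_le deltaN.
have dv : 128 * (128 * (d%:R + 1)) * v <= 1 by rewrite -[leRHS]n2inv ler_pM2r.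
have gv : gap * n ^+ 2 <= 32.
  by rewrite -ler_pdivlMr // exprn_gt0.
have d0 : 0 <= d%:R :> R by [].
pose beta := 2 * gap - delta.
(* Twice the gap is at least 1 / N^2, which exceeds [delta] because [d] is at least 1. *)
have beta0 : 0 < beta.
  have : delta < v.
    rewrite /delta /v ltf_pV2 ?posrE ?exprn_gt0 // exprD -[X in X < _]mul1r.
    rewrite ltr_pM2r ?exprn_gt0 //.
    by rewrite exprn_egt1 // -lt0n.
  have : 1 / (2 * n ^+ 2) = v / 2 by rewrite /v; field; rewrite gt_eqF.
  by rewrite /beta; lra.
have bd : beta + delta = 2 * gap by rewrite /beta subrK.
have bv : beta <= 64 * v by rewrite /beta; lra.
have dv0 := mulr_ge0 d0 (ltW n2i0).
have beta1 : beta <= 1 by lra.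
have inv_dN : (delta * (N ^ d)%:R)^-1 = n ^+ 2 by rewrite deltaN invrK.
have small : 4 + 4 * beta + 16 * d%:R * gap ^+ 2 / (delta * (N ^ d)%:R) <= 6.
  rewrite inv_dN.
  have : 16 * d%:R * gap ^+ 2 * n ^+ 2 <= 128 * (128 * (d%:R * v)).
    rewrite (_ : _ * n ^+ 2 = 16 * d%:R * (gap * (gap * n ^+ 2))); last by ring.
    have : gap * (gap * n ^+ 2) <= 32 * v * 32.
      by apply: ler_pM => //; rewrite ?mulr_ge0 ?exprn_ge0 ?(ltW gap0) ?(ltW n0).
    by move=> /(ler_wpM2l d0); lra.
  by lra.
have lyap : lyapunov beta S 0 <= CL.
  rewrite lyapunov0 //; apply: le_trans (sum_mode_weight_le d N4 beta0 delta0 bd) _.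
  rewrite inv_dN /CL lerD2l -mulrA.
  have : 16 * d%:R * (gap * n ^+ 2) <= 16 * d%:R * 32 by rewrite ler_wpM2l // mulr_ge0.
  rewrite -/gap; lra.
have := gradient_moment_le N4 beta0 delta0 bd beta1 small semiS genS lyap t0 xy.
have W0 := decay_weight_gt0 d N beta t.
set g := gradient_moment S _ t x y => Wg.
have {Wg} : g <= 4 * bootstrap_const d CL / decay_weight d N beta t.
  by rewrite ler_pdivlMr // mulrC.
move/le_trans; apply.
rewrite /decay_weight invfM mulrA.
have -> : - (2 * t / relaxation_time R N) + 1 * t * delta = - (beta * t).
  rewrite /relaxation_time -cosZ1 // -/gap /beta.
  by field; rewrite gt_eqF.
rewrite expRN ler_pM2r ?invr_gt0 ?expR_gt0 // ler_pM2l //.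
have ts0 : 0 < time_scale N t by rewrite lt_max ltr01.
rewrite lef_pV2 ?posrE ?exprn_gt0 ?lt_max ?ltr01 ?orbT //.
(* The statement takes minimum and maximum after raising to the power, [time_scale] takes them
   before. *)
rewrite ge_max; apply/andP; split; last first.
  by rewrite exprn_ege1 // le_max lexx.
have -> : n ^+ (2 * d + 2) = (n ^+ 2) ^+ d.+1.
  by rewrite -exprM e22.
rewrite addn1 /time_scale -/n.
apply: (@le_trans _ _ (Num.min (n ^+ 2) t ^+ d.+1)).
  by rewrite ge_min; case: (leP (n ^+ 2) t) => _; rewrite lexx ?orbT.
rewrite lerXn2r // ?nnegrE ?le_max ?ler01 //.
  by rewrite le_min t0 exprn_ge0 // ltW.
by rewrite lexx orbT.
Qed.
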